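(* Let $G=(V,E)$ be a finite connected graph with $|V|\ge3$, $x_0\in V$, and let $\alpha_c^1(\delta)$, $\delta\in(0,\infty)$, be the critical exponent for exponential integrability of the edge cover time $C_E$ of the $\delta$-once-reinforced random walk on $G$ started at $x_0$. Then: (a) $\alpha_c^1(\delta)$ is continuous and strictly decreasing in $\delta>0$, and uniformly continuous on $\{\delta\ge\delta_0\}$ for any $\delta_0>0$. (b) $\lim_{\delta\to\infty}\alpha_c^1(\delta)=0$. (c) $\lim_{\delta\to0+}\alpha_c^1(\delta)=\infty$ when $G$ is a connected graph with exactly 3 vertices or a star-shaped graph, and $\lim_{\delta\to0+}\alpha_c^1(\delta)<\infty$ otherwise.
   Context: $G=(V,E)$ is undirected; $u\sim v$ means $u,v$ are adjacent, and the corresponding edge is $uv=\{u,v\}$. A star-shaped graph is a graph in which all edges share one common vertex (i.e. $K_{1,m}$). For $\delta>0$, the $\delta$-once-reinforced random walk started at $x_0$ is the process $(X_n)_{n\ge0}$ on $V$ with $X_0=x_0$ and, for $u\sim v$, $\mathbb{P}(X_{n+1}=u\mid X_n=v,\mathscr{F}_n)=w_n(uv)/\sum_{u'\sim v}w_n(u'v)$, where $\mathscr{F}_n$ is the natural filtration and $w_n(e)=\delta$ if $X_iX_{i+1}=e$ for some $i<n$, $w_n(e)=1$ otherwise. The edge cover time is $C_E=\inf\{t:\forall e\in E\ \exists\,s\le t,\ X_{s-1}X_s=e\}$. The exponent is given by the following formula. Let $\mathscr{S}$ be the collection of edge sets $E'\subseteq E$ such that the graph $(V',E')$, where $V'$ is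 the set of all endpoints of edges of $E'$, is connected and some edge of $E'$ contains $x_0$. Let $\mathscr{S}_1=\mathscr{S}\setminus\{E\}$. For $E'\subseteq E$ and $y\sim x$ put $$\hat p_{E'}(x,y)=\frac{g(\delta,E',xy)}{\sum_{z\sim x}g(\delta,E',xz)},\qquad g(\delta,E',xy)=\delta\,\mathbf 1_{\{xy\in E'\}}+\mathbf 1_{\{xy\notin E'\}}.$$ For $E_0\subseteq E$ let $V_0$ be the set of endpoints of edges of $E_0$, and let $\mathscr{T}(E_0)$ be the set of transition kernels $q$ from $V_0$ to $V$ with $q(x,y)>0$ only if $xy\in E_0$. $\mathscr{P}(V)$ is the set of probability measures on $V$. $R(\cdot\|\cdot)$ is relative entropy, and $\int_V R(\hat q\|\hat p_{E_0})\,d\nu=\sum_x\nu(x)R(\hat q(x,\cdot)\|\hat p_{E_0}(x,\cdot))$. Then $$\alpha_c^1(\delta)=\inf\left\{\int_V R(\hat q\|\hat p_{E_0})\,d\nu:\ E_0\in\mathscr{S}_1,\ \hat q\in\mathscr{T}(E_0),\ \nu\in\mathscr{P}(V),\ \nu\hat q=\nu,\ \mathrm{supp}(\nu)\subseteq V_0\right\}.$$ *)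

(* Defs.v *)
From HB Require Import structures.
From mathcomp Require Import all_boot all_order all_algebra.
From mathcomp Require Import all_classical all_reals all_analysis.
Import Order.TTheory GRing.Theory Num.Theory.
Import numFieldNormedType.Exports.

Set Implicit Arguments.
Unset Strict Implicit.
Unset Printing Implicit Defensive.

Local Open Scope ring_scope.

(* A simple graph is a symmetric irreflexive relation e on V; the edge uv is
   the unordered pair {u, v}. *)
Section Graph.
Variables (V : finType) (e : rel V).

Definition edge (u v : V) : {set V} := [set u; v]%SET.

Definition edges : {set {set V}} := [set edge p.1 p.2 | p : V * V & e p.1 p.2]%SET.

Definition graph_connected := forall u v : V, connect e u v.

Definition star_shaped := exists c : V, forall f, f \in edges -> c \in f.

Definition endpoints (E0 : {set {set V}}) : {set V} := finset.cover E0.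

Definition edge_set_connected (E0 : {set {set V}}) :=
  forall u v, u \in endpoints E0 -> v \in endpoints E0 ->
    connect (fun a b => edge a b \in E0) u v.

Definition calS (x0 : V) (E0 : {set {set V}}) :=
  [/\ E0 \subset edges, edge_set_connected E0 & x0 \in endpoints E0].

Definition calS1 (x0 : V) (E0 : {set {set V}}) :=
  calS x0 E0 /\ E0 <> edges.

(* The edges X_0X_1, ..., X_{n-1}X_n of a trajectory. *)
Definition traversed (x : nat -> V) (n : nat) : {set {set V}} :=
  [set edge (x i) (x i.+1) | i : 'I_n]%SET.

End Graph.

Local Open Scope classical_set_scope.

Section Kernels.
Variables (R : realType) (V : finType) (e : rel V).

Definition weight (delta : R) (E0 : {set {set V}}) (f : {set V}) : R :=
  if f \in E0 then delta else 1.

Definition phat (delta : R) (E0 : {set {set V}}) (x y : V) : R :=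
  if e x y then
    weight delta E0 (edge x y) / \sum_(z | e x z) weight delta E0 (edge x z)
  else 0.

Definition prob_vec (m : V -> R) :=
  (forall x, 0 <= m x) /\ \sum_x m x = 1.

Definition rel_entropy (m p : V -> R) : \bar R :=
  (\sum_y (if m y == 0%R then 0
           else if p y == 0%R then +oo
           else (m y * ln (m y / p y))%:E))%E.

(* Kernels from V_0 to V are functions of two variables in V whose rows
   outside V_0 are irrelevant. *)
Definition calT (E0 : {set {set V}}) (q : V -> V -> R) :=
  forall x, x \in endpoints E0 ->
    prob_vec (q x) /\ (forall y, 0 < q x y -> edge x y \in E0).

Definition stationary (E0 : {set {set V}}) (nu : V -> R) (q : V -> V -> R) :=
  forall y, \sum_(x in endpoints E0) nu x * q x y = nu y.

Definition entropy_cost (delta : R) (E0 : {set {set V}})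
    (q : V -> V -> R) (nu : V -> R) : \bar R :=
  (\sum_(x in endpoints E0)
     (nu x)%:E * rel_entropy (q x) (phat delta E0 x))%E.

Definition alpha_c1 (x0 : V) (delta : R) : \bar R :=
  ereal_inf [set c | exists (E0 : {set {set V}}) (q : V -> V -> R) (nu : V -> R),
    [/\ calS1 e x0 E0, calT E0 q, prob_vec nu /\ stationary E0 nu q,
        (forall x, nu x != 0 -> x \in endpoints E0)
      & c = entropy_cost delta E0 q nu]].

End Kernels.

Section Walk.
Variables (R : realType) (V : finType) (e : rel V).
Variables (d : measure_display) (T : measurableType d) (P : probability T R).

(* The conditional law of X_{n+1} given the natural filtration is stated on
   the atoms {X_0 = x_0, ..., X_n = x_n} of the sigma-algebra F_n. *)
Definition once_reinforced_walk (delta : R) (x0 : V) (X : nat -> T -> V) :=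
  [/\ forall n v, measurable [set w | X n w = v],
      P [set w | X 0%N w = x0] = 1%E
    & forall n (x : nat -> V) u, e (x n) u ->
        P [set w | (forall i, (i <= n)%N -> X i w = x i) /\ X n.+1 w = u] =
        (P [set w | forall i, (i <= n)%N -> X i w = x i] *
         (weight delta (traversed x n) (edge (x n) u) /
          \sum_(z | e (x n) z)
             weight delta (traversed x n) (edge (x n) z))%:E)%E].

(* inf of the empty set is +oo *)
Definition edge_cover_time (X : nat -> T -> V) (w : T) : \bar R :=
  ereal_inf [set t%:R%:E | t in
    [set t | edges e \subset traversed (fun i => X i w) t]].

Definition critical_exponent (X : nat -> T -> V) : \bar R :=
  ereal_sup [set a%:E | a in
    [set a : R | (\int[P]_w expeR (a%:E * edge_cover_time X w) < +oo)%E]].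

End Walk.

(* Main.v *)
Require Import Defs.
From HB Require Import structures.
From mathcomp Require Import all_boot all_order all_algebra.
From mathcomp Require Import all_classical all_reals all_analysis.
From mathcomp Require Import measurable_realfun ring lra.
Import Order.TTheory GRing.Theory Num.Theory.
Import numFieldNormedType.Exports.

(** While the set of covered edges is [E0], the walk is a Markov chain with kernel
    [phat delta E0], killed when it crosses a new edge. This kernel is reversible:
    multiplied by the total weight at its starting point it is the symmetric
    matrix of conductances. Hence the probability that the phase [E0] lasts for
    [n] steps decays like [radius delta E0 ^+ n], where [radius], the spectral
    radius of the killed kernel, is a maximum of Rayleigh quotients attained at a
    positive Perron vector ([perron], [perron_vector]).

    The exponent is the smallest of the numbers [- ln (radius delta E0)]. On the
    side of the variational formula this is the Donsker-Varadhan principle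
    ([alpha_c1E]). The cost of a kernel [q] is compared with the Doob transform of
    [phat] by the Perron vector: the difference is a relative entropy plus the
    mean increment of a potential, which vanishes under a stationary law; the Doob
    transform itself, with its reversible law, attains the bound. On the side of
    the walk ([critical_exponentE]), the pair (covered edges, position) is a finite
    Markov chain. Perron vectors of the phases, weighted by a large constant to
    the number of uncovered edges, form a supersolution and bound the tail of the
    cover time from above ([uncovered_prob_le]); a single phase, which is reached
    with positive probability, bounds it from below ([uncovered_prob_ge]). The
    exponential moment is a series in the tail probabilities
    ([cover_time_moment]), so these bounds decide its finiteness.

    The rest follows by comparing Rayleigh quotients. The total weight divided by
    [delta] decreases with [delta], strictly at a vertex with an edge outside
    [E0], and the Perron vector is positive there; so each radius is strictly
    increasing ([radius_increasing]). The radius changes at most by the factor by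
    which [delta] does, so the exponent is a 1-Lipschitz function of [ln delta]
    ([exponent_log_lipschitz]). For a single edge the radius tends to one as
    [delta] grows. As [delta] tends to zero, a phase keeps a radius bounded away
    from zero if [E0] contains an edge [uv] together with all edges at [u] and at
    [v]. Such an [E0] exists as soon as two edges of the graph are disjoint
    ([saturated_edge_ex]), that is, unless the graph is a star or has three
    vertices ([edges_meetP]); in those cases each edge of [E0] has an end that
    lies on an edge outside [E0], and the radius is at most of order
    [Num.sqrt delta] ([radius_le_sqrt]). *)

Set Implicit Arguments.
Unset Strict Implicit.
Unset Printing Implicit Defensive.
Local Open Scope ring_scope.
Local Open Scope classical_set_scope.

(** * Rayleigh quotients and the Perron vector *)

Lemma continuous_mul (R : realType) (X : topologicalType) (f g : X -> R) :
  continuous f -> continuous g -> continuous (fun z => f z * g z).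
Proof. by move=> cf cg z; apply: cvgM; [exact: cf|exact: cg]. Qed.

Lemma continuous_sum (R : realType) (X : topologicalType) (I : finType)
    (F : I -> X -> R) :
  (forall i, continuous (F i)) -> continuous (fun z => \sum_i F i z).
Proof. by move=> Fc; apply: continuous_big => //; exact: add_continuous. Qed.

Lemma continuous_within_div (R : realType) (X : topologicalType) (A : set X)
    (f g : X -> R) : continuous f -> continuous g ->
  (forall z, A z -> g z != 0) -> {within A, continuous (fun z => f z / g z)}.
Proof.
move=> cf cg g0; apply: continuous_in_subspaceT => z /set_mem/g0 gz0.
by apply: cvgM; [exact: cf|apply: cvgV => //; exact: cg].
Qed.

Section Perron.
Variables (R : realType) (I : finType) (A : I -> I -> R) (d : I -> R).
Hypotheses (A_sym : forall x y, A x y = A y x) (A_ge0 : forall x y, 0 <= A x y).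
Hypothesis d_gt0 : forall x, 0 < d x.

Definition quad_form (g : I -> R) : R := \sum_x \sum_y A x y * (g x * g y).
Definition diag_form (g : I -> R) : R := \sum_x d x * g x ^+ 2.

Lemma quad_formZ c g : quad_form (fun x => c * g x) = c ^+ 2 * quad_form g.
Proof.
rewrite /quad_form mulr_sumr; apply: eq_bigr => x _.
by rewrite mulr_sumr; apply: eq_bigr => y _; ring.
Qed.

Lemma diag_formZ c g : diag_form (fun x => c * g x) = c ^+ 2 * diag_form g.
Proof. by rewrite /diag_form mulr_sumr; apply: eq_bigr => x _; ring. Qed.

Lemma diag_form_gt0 g x : g x != 0 -> 0 < diag_form g.
Proof.
move=> gx; rewrite /diag_form (bigD1 x)//= ltr_pwDl//.
  by rewrite mulr_gt0// exprn_even_gt0.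
by apply: sumr_ge0 => y _; rewrite mulr_ge0 ?sqr_ge0// ltW.
Qed.

Lemma quad_form_norm g : quad_form g <= quad_form (fun x => `|g x|).
Proof.
apply: ler_sum => x _; apply: ler_sum => y _.
by rewrite ler_wpM2l// -normrM ler_norm.
Qed.

Lemma diag_form_norm g : diag_form (fun x => `|g x|) = diag_form g.
Proof. by apply: eq_bigr => x _; rewrite real_normK// num_real. Qed.

Lemma quad_formD c f g : quad_form (fun x => f x + c * g x) =
  quad_form f + 2 * c * (\sum_x g x * \sum_y A x y * f y) + c ^+ 2 * quad_form g.
Proof.
have cross : \sum_x \sum_y A x y * (f x * g y) =
    \sum_x g x * \sum_y A x y * f y.
  rewrite exchange_big; apply: eq_bigr => x _; rewrite mulr_sumr.
  by apply: eq_bigr => y _; rewrite A_sym; ring.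
rewrite -[2]/(1 + 1 : R) mulrDl mul1r mulrDl -{1}cross /quad_form !mulr_sumr.
rewrite -!big_split; apply: eq_bigr => x _ /=.
rewrite !mulr_sumr -!big_split; apply: eq_bigr => y _ /=.
ring.
Qed.

Lemma diag_formD c f g : diag_form (fun x => f x + c * g x) =
  diag_form f + 2 * c * (\sum_x g x * (d x * f x)) + c ^+ 2 * diag_form g.
Proof.
rewrite /diag_form !mulr_sumr -!big_split.
by apply: eq_bigr => x _ /=; ring.
Qed.

(** The quotient is homogeneous of degree zero and does not decrease when [g] is
    replaced by its absolute value, so it suffices to maximise it over the
    standard simplex, which is compact. *)
Lemma rayleigh_max : (0 < #|I|)%N ->
  exists rho (h : I -> R), [/\ forall x, 0 <= h x, 0 < \sum_x h x,
    quad_form h = rho * diag_form h & forall g, quad_form g <= rho * diag_form g].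
Proof.
move=> /card_gt0P[i0 _].
pose X : topologicalType := prod_topology (fun _ : I => R).
pose simplex : set X := [set f | (forall x, `[0, 1] (f x)) /\ \sum_x f x = 1].
have evc x : continuous (fun f : X => (f x : R)).
  exact: (@proj_continuous I (fun=> R) x).
have cstc (c : R) : continuous (fun _ : X => c) := @cst_continuous X R c.
have diag_form_simplex f : simplex f -> 0 < diag_form f.
  move=> [_ f1]; have [x fx0] : exists x, f x != 0.
    apply: contrapT => /forallNP f0; move/eqP: f1; apply/negP.
    rewrite big1 ?(eq_sym 0) ?oner_eq0// => x _.
    by apply/eqP/negPn/negP; exact: f0.
  exact: diag_form_gt0 fx0.
have cpt : compact simplex.
  apply: (@subclosed_compact _ _ [set f : X | forall x, `[0, 1] (f x)]).
  - have -> : simplex = (\bigcap_x ((fun f : X => f x) @^-1` `[0, 1])) `&`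
        ((fun f : X => \sum_x f x) @^-1` [set 1]).
      apply/seteqP.
      by split=> [f [f01 f1]|f [f01 f1]]; split=> // x; [move=> _|]; exact: f01.
    apply: closedI; last first.
      apply: preimage_closed; last exact: closed_eq.
      by move=> ? _; exact: (@continuous_sum R X).
    apply: closed_bigI => x _.
    by apply: preimage_closed; [move=> ? _; exact: evc|exact: itv_closed].
  - apply: (@tychonoff I (fun=> R) (fun=> `[0, 1]%classic)) => _.
    exact: segment_compact.
  - by move=> f [].
have ne : simplex !=set0.
  exists (fun x => (x == i0)%:R); split=> [x|].
    by rewrite /= in_itv/= ler0n lern1 leq_b1.
  by rewrite (bigD1 i0)//= eqxx big1 ?addr0// => j /negPf ->.
have cont : {within simplex, continuous (fun f : X => quad_form f / diag_form f)}.
  apply: continuous_within_div => [||f /diag_form_simplex Nf]; last first.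
  - by rewrite gt_eqF.
  - apply: (@continuous_sum R X I (fun x f => d x * f x ^+ 2)) => x.
    by apply: continuous_mul => //; apply: continuous_mul; exact: evc.
  - apply: (@continuous_sum R X I (fun x f => \sum_y A x y * (f x * f y))) => x.
    apply: (@continuous_sum R X I (fun y f => A x y * (f x * f y))) => y.
    by apply: continuous_mul => //; apply: continuous_mul; exact: evc.
have [h /set_mem hs hmax] := compact_EVT_max ne cpt cont.
have h_ge0 x : 0 <= h x by have [/(_ x)] := hs; rewrite /= in_itv => /= /andP[].
exists (quad_form h / diag_form h), h; split => //.
- by have [_ ->] := hs.
- by rewrite divfK// gt_eqF// diag_form_simplex.
move=> g; apply: (le_trans (quad_form_norm g)); rewrite -(diag_form_norm g).
set f := fun x => `|g x|.
have [f0|fN0] := eqVneq (\sum_x f x) 0.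
  have {}f0 x : f x = 0.
    by apply: (psumr_eq0P _ f0) => // y _; rewrite /f.
  rewrite /quad_form big1; last first.
    by move=> x _; rewrite big1// => y _; rewrite f0 mul0r mulr0.
  have -> : diag_form f = 0 by apply: big1 => x _; rewrite f0 expr0n mulr0.
  by rewrite mulr0.
set s := \sum_x f x in fN0.
have s_gt0 : 0 < s.
  by rewrite lt_neqAle eq_sym fN0 sumr_ge0// => x _; rewrite /f.
have sf : simplex (fun x => s^-1 * f x).
  split=> [x|]; last by rewrite -mulr_sumr mulVf.
  rewrite /= in_itv/=; apply/andP; split.
    by rewrite mulr_ge0 ?invr_ge0 ?(ltW s_gt0)// /f.
  rewrite ler_pdivrMl// mulr1 /s (bigD1 x)//= lerDl sumr_ge0// => y _.
  by rewrite /f.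
have /(_ (mem_set sf)) := hmax (fun x => s^-1 * f x).
rewrite quad_formZ diag_formZ -mulf_div divff ?mul1r ?expf_neq0 ?invr_eq0// => Hm.
have := diag_form_simplex _ sf; rewrite diag_formZ pmulr_rgt0; last first.
  by rewrite exprn_even_gt0// invr_eq0.
by move=> Nf; rewrite -ler_pdivrMr.
Qed.

(** First-order optimality of the maximiser [h], tested in the direction of the
    residual [r] of the eigenvalue equation: the derivative there is twice the
    sum of the squares of [r]. *)
Lemma perron : (0 < #|I|)%N ->
  exists rho (h : I -> R), [/\ forall x, 0 <= h x, 0 < \sum_x h x,
    forall x, \sum_y A x y * h y = rho * (d x * h x)
    & forall g, quad_form g <= rho * diag_form g].
Proof.
move=> /rayleigh_max[rho [h [h0 hs hE hmax]]]; exists rho, h; split => //.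
pose r x := \sum_y A x y * h y - rho * (d x * h x).
suff r0 x : r x = 0 by move=> x; apply/eqP; rewrite -subr_eq0 -/(r x) r0.
pose L := \sum_x r x ^+ 2; pose M := quad_form r - rho * diag_form r.
have key c : 2 * c * L + c ^+ 2 * M <= 0.
  have := hmax (fun x => h x + c * r x); rewrite quad_formD diag_formD hE -subr_le0.
  rewrite (_ : L = (\sum_x r x * \sum_y A x y * h y) -
    rho * \sum_x r x * (d x * h x)); last first.
    rewrite /L mulr_sumr -sumrB; apply: eq_bigr => z _.
    by rewrite expr2 {2}/r; ring.
  by apply: le_trans; rewrite le_eqVlt; apply/orP; left; apply/eqP; rewrite /M; ring.
(* For small c > 0 the linear term would win over the quadratic one. *)
have L0 : L = 0.
  apply/eqP; rewrite eq_le sumr_ge0 ?andbT; last by move=> y _; rewrite sqr_ge0.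
  rewrite leNgt; apply/negP => L0.
  have M0 : 0 <= `|M| by [].
  have M1 : 0 < `|M| + 1 by rewrite ltr_wpDl.
  have := key (L / (`|M| + 1)).
  have -> : 2 * (L / (`|M| + 1)) * L + (L / (`|M| + 1)) ^+ 2 * M =
     (L / (`|M| + 1)) ^+ 2 * (2 * (`|M| + 1) + M) by field; rewrite gt_eqF.
  rewrite pmulr_rle0; last by rewrite exprn_gt0// divr_gt0.
  by have := ler_norm (- M); rewrite normrN; lra.
apply/eqP; rewrite -sqrf_eq0; apply/eqP/(psumr_eq0P _ L0) => // y _.
by rewrite sqr_ge0.
Qed.
End Perron.

(** * Edge sets of a finite connected graph *)

Section GraphFacts.
Variables (V : finType) (e : rel V).
Hypotheses (e_sym : symmetric e) (e_irr : irreflexive e).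

Lemma edgeC (u v : V) : edge u v = edge v u.
Proof. by rewrite /edge finset.setUC. Qed.

Lemma in_edge (u v x : V) : (x \in edge u v) = (x == u) || (x == v).
Proof. by rewrite !inE. Qed.

Lemma edgesP f : reflect (exists u v, f = edge u v /\ e u v) (f \in edges e).
Proof.
apply: (iffP imsetP) => [[[u v]]|[u [v [-> euv]]]].
  by rewrite inE /= => euv ->; exists u, v.
by exists (u, v); rewrite ?inE.
Qed.

Lemma edge_inj (u v w : V) : edge u v = edge u w -> v = w.
Proof.
move=> E; have : v \in edge u w by rewrite -E in_edge eqxx orbT.
rewrite in_edge => /orP[/eqP vu|/eqP//].
have : w \in edge u v by rewrite E in_edge eqxx orbT.
by rewrite in_edge -vu orbb => /eqP.
Qed.

Lemma mem_edges (u v : V) : (edge u v \in edges e) = e u v.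
Proof.
apply/edgesP/idP => [[a [b [E eab]]]|euv]; last by exists u, v.
have : a \in edge u v by rewrite E in_edge eqxx.
rewrite in_edge => /orP[] /eqP au; subst a.
  by rewrite (edge_inj E).
by move: E; rewrite edgeC => /edge_inj ->; rewrite e_sym.
Qed.

Lemma edge_adjacent (E0 : {set {set V}}) x y :
  E0 \subset edges e -> edge x y \in E0 -> e x y.
Proof. by move=> /fintype.subsetP sE /sE; rewrite mem_edges. Qed.

Lemma endpointsP (E0 : {set {set V}}) x : E0 \subset edges e ->
  reflect (exists y, edge x y \in E0) (x \in endpoints E0).
Proof.
move=> /fintype.subsetP sE; apply: (iffP bigcupP) => [[f fE]|[y xyE]].
  have /edgesP[u [v [fuv _]]] := sE _ fE.
  rewrite fuv in_edge => /orP[] /eqP ->; first by exists v; rewrite -fuv.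
  by exists u; rewrite edgeC -fuv.
by exists (edge x y) => //; rewrite in_edge eqxx.
Qed.

Lemma endpoint_l (E0 : {set {set V}}) x y : edge x y \in E0 -> x \in endpoints E0.
Proof. by move=> xyE; apply/bigcupP; exists (edge x y); rewrite ?in_edge ?eqxx. Qed.

Lemma endpoint_r (E0 : {set {set V}}) x y : edge x y \in E0 -> y \in endpoints E0.
Proof. by rewrite edgeC; exact: endpoint_l. Qed.

Lemma endpointsU (E0 : {set {set V}}) u v x :
  (x \in endpoints (edge u v |: E0)%SET) = [|| x == u, x == v | x \in endpoints E0].
Proof.
by rewrite /endpoints /finset.cover finset.bigcup_setU finset.big_set1 !inE -orbA.
Qed.

Lemma endpoints1 (u v x : V) :
  (x \in endpoints [set edge u v]%SET) = (x == u) || (x == v).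
Proof. by rewrite /endpoints /finset.cover finset.big_set1 in_edge. Qed.

Definition step (E0 : {set {set V}}) : rel V := fun a b => edge a b \in E0.

Lemma step_sym E0 : symmetric (step E0).
Proof. by move=> a b; rewrite /step edgeC. Qed.

Lemma calS_edge x y : e x y -> calS e x [set edge x y]%SET.
Proof.
move=> exy; split.
- by apply/fintype.subsetP => f; rewrite inE => /eqP ->; rewrite mem_edges.
- have cxy : connect (step [set edge x y]%SET) x y.
    by apply: connect1; rewrite /step inE.
  have cyx : connect (step [set edge x y]%SET) y x.
    by apply: connect1; rewrite /step inE edgeC.
  move=> u v; rewrite !endpoints1 => /orP[]/eqP-> /orP[]/eqP->//.
- by rewrite endpoints1 eqxx.
Qed.

(** Every endpoint of the enlarged set is still joined to [x]. *)
Lemma calSU x0 E0 x y : calS e x0 E0 -> x \in endpoints E0 -> e x y ->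
  calS e x0 (edge x y |: E0)%SET.
Proof.
move=> [sE cE x0E] xE exy; split; last by rewrite endpointsU x0E !orbT.
  by rewrite finset.subUset sE andbT finset.sub1set mem_edges.
set F := (edge x y |: E0)%SET.
have sub a b : step E0 a b -> connect (step F) a b.
  by move=> abE; apply: connect1; rewrite /step finset.in_setU; apply/orP; right.
have tox u : u \in endpoints F -> connect (step F) u x.
  have xyF : connect (step F) x y by apply: connect1; rewrite /step !inE eqxx.
  rewrite endpointsU => /or3P[/eqP->//|/eqP->|uE].
    by rewrite (sym_connect_sym (@step_sym F)).
  by apply: (connect_sub sub); exact: cE.
move=> u v uF vF; apply: (connect_trans (tox u uF)).
by rewrite (sym_connect_sym (@step_sym F)) tox.
Qed.

Hypotheses (e_conn : graph_connected e) (V_ge3 : (3 <= #|V|)%N).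

Lemma neighbor_ex x : exists y, e x y.
Proof.
have /card_gt0P[z] : (0 < #|[set~ x]%SET|)%N.
  by rewrite cardsC1 -subn1 ltn_subRL addn0 (leq_trans _ V_ge3).
rewrite !inE => zx.
have /connectP[[|y p] /= ep zl] := e_conn x z; first by rewrite zl eqxx in zx.
by exists y; case/andP: ep.
Qed.

(** If [xy] were the only edge, [x] and [y] would be the only vertices. *)
Lemma calS1_edge x y : e x y -> calS1 e x [set edge x y]%SET.
Proof.
move=> exy; split; first exact: calS_edge.
move=> E1; have Ve z : z \in [set x; y]%SET.
  have [w ezw] := neighbor_ex z.
  have : edge z w \in [set edge x y]%SET by rewrite E1 mem_edges.
  by move=> /endpoint_l; rewrite endpoints1 !inE.
have VE : #|V| = #|[set x; y]%SET|.
  by rewrite -finset.cardsT; apply: eq_card => z; rewrite Ve !inE.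
by move: V_ge3; rewrite VE cards2; case: eqP.
Qed.

Lemma closed_full (P : pred V) x :
  P x -> (forall a b, e a b -> P a -> P b) -> forall y, P y.
Proof.
move=> Px Pe y; have /connectP[p ep ->] := e_conn x y.
elim: p x Px ep => //= b p IH a Pa /andP[eab ep].
by apply: (IH b) => //; exact: Pe eab Pa.
Qed.

(** Otherwise the endpoints would be closed under adjacency, hence everything. *)
Lemma unsaturated_ex x0 E0 : calS1 e x0 E0 ->
  exists x y, [/\ x \in endpoints E0, e x y & edge x y \notin E0].
Proof.
move=> [[sE cE x0E] neE]; apply: contrapT => Hno.
have full a b : e a b -> a \in endpoints E0 -> edge a b \in E0.
  by move=> eab aE; apply/negPn/negP => nE; apply: Hno; exists a, b.
have allV : forall y, y \in endpoints E0.
  by apply: (closed_full x0E) => a b eab aE; exact: endpoint_r (full a b eab aE).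
apply: neE; apply/eqP; rewrite finset.eqEsubset sE /=.
by apply/fintype.subsetP => f /edgesP[u [v [-> euv]]]; exact: full.
Qed.

Definition edges_meet := forall f g, f \in edges e -> g \in edges e ->
  exists x, x \in f /\ x \in g.

(** If no vertex lies on all edges, some edge avoids [a] and some edge avoids [b]
    for a given edge [ab]; as all edges meet, these close a triangle [abc], and
    an edge at a fourth vertex would miss one of its sides. *)
Lemma edges_meetP : (#|V| = 3%N \/ star_shaped e) <-> edges_meet.
Proof.
split=> [[V3|[c cE]] f g fE gE|meet]; last 1 first.
- have [star|nstar] := pselect (star_shaped e); [by right|left].
  have noc c : exists f, f \in edges e /\ c \notin f.
    apply: contrapT => H; apply: nstar; exists c => f fE.
    by apply/negPn/negP => cf; apply: H; exists f.
  have [a _] : exists a : V, a \in V by apply/card_gt0P; exact: leq_trans V_ge3.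
  have [b eab] := neighbor_ex a.
  have ab : a != b by apply: contraTneq eab => ->; rewrite e_irr.
  have abE : edge a b \in edges e by rewrite mem_edges.
  have third u v : edge u v \in edges e -> exists w, e v w /\ w != u.
    move=> uvE; have [f [fE uf]] := noc u.
    have [z [zf]] := meet _ _ fE uvE.
    rewrite in_edge => /orP[] /eqP zE; subst z; first by rewrite zf in uf.
    have /edgesP[p [q [fpq epq]]] := fE.
    move: zf uf; rewrite fpq !in_edge negb_or => /orP[] /eqP -> /andP[up uq].
      by exists q; rewrite eq_sym.
    by exists p; rewrite e_sym eq_sym.
  have [c [ebc ca]] := third a b abE.
  have bc : b != c by apply: contraTneq ebc => ->; rewrite e_irr.
  have eac : e a c.
    have [d [ead db]] := third b a ltac:(by rewrite edgeC).
    have [z []] := meet (edge a d) (edge b c) ltac:(by rewrite mem_edges)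
      ltac:(by rewrite mem_edges).
    rewrite !in_edge => /orP[] /eqP -> /orP[] /eqP E.
    + by rewrite E eqxx in ab.
    + by rewrite E eqxx in ca.
    + by rewrite E eqxx in db.
    + by rewrite -E.
  have VE x : x \in [set a; b; c]%SET.
    rewrite !inE; apply: contrapT => /negP; rewrite !negb_or -andbA => /and3P[xa xb xc].
    have [y exy] := neighbor_ex x.
    have mxy u v : e u v -> x != u -> x != v -> y \in edge u v.
      move=> euv xu xv; have [z []] := meet (edge x y) (edge u v)
         ltac:(by rewrite mem_edges) ltac:(by rewrite mem_edges).
      rewrite in_edge => /orP[]/eqP-> //.
      by rewrite in_edge (negPf xu) (negPf xv).
    have := mxy _ _ eab xa xb; have := mxy _ _ eac xa xc; have := mxy _ _ ebc xb xc.
    rewrite !in_edge => /orP[]/eqP-> /orP[] /eqP E /orP[] /eqP E';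
      move: ab bc ca; rewrite ?E ?E' ?eqxx //; by rewrite -?E -?E' ?eqxx.
  have <- : #|[set a; b; c]%SET| = 3%N.
    by rewrite finset.setUC cardsU1 cards2 !inE negb_or ca eq_sym bc ab.
  by rewrite -finset.cardsT; apply: eq_card => x; rewrite VE !inE.
- have [u [v [-> euv]]] := edgesP _ fE; have [p [q [-> epq]]] := edgesP _ gE.
  have uv : u != v by apply: contraTneq euv => ->; rewrite e_irr.
  have pq : p != q by apply: contraTneq epq => ->; rewrite e_irr.
  have /set0Pn[x] : (edge u v :&: edge p q)%SET != finset.set0.
    apply/negP => /eqP I0.
    have := max_card (mem (edge u v :|: edge p q)%SET).
    by rewrite cardsU I0 cards0 subn0 !cards2 uv pq V3.
  by rewrite inE => /andP[? ?]; exists x.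
- by exists c; split; exact: cE.
Qed.

(** The first vertex of [f] or [g] met on the way from [x0] is reached without
    crossing either edge. *)
Lemma reach_avoiding x0 (f g : {set V}) y : y \in f ->
  exists z, (z \in f \/ z \in g) /\
    connect [rel a b | [&& e a b, a \notin f & a \notin g]] x0 z.
Proof.
set r := [rel a b | _]; have /connectP[p ep ->] := e_conn x0 y.
elim: p x0 ep => [|b p IH] x /=; first by move=> _ xf; exists x; split; [left|].
move=> /andP[exb ep] /(IH _ ep)[z [zfg bz]].
have [xf|xf] := boolP (x \in f); first by exists x; split; [left|].
have [xg|xg] := boolP (x \in g); first by exists x; split; [right|].
exists z; split=> //; apply: connect_trans bz; apply: connect1.
by rewrite /r /= exb xf xg.
Qed.

(** Of two disjoint edges, let [g] be one that [x0] reaches without crossing the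
    other, [f]. The edges other than [f] that are reachable from [x0] once [f] is
    removed contain every edge at either end of [g], because [f] avoids both. *)
Lemma saturated_edge_ex x0 : ~ edges_meet -> exists E0 u v,
  [/\ calS1 e x0 E0, edge u v \in E0, forall z, e u z -> edge u z \in E0
    & forall z, e v z -> edge v z \in E0].
Proof.
move=> nmeet.
have [f [g [fE gE dis]]] : exists f g,
    [/\ f \in edges e, g \in edges e & forall x, x \in f -> x \in g -> False].
  apply: contrapT => H; apply: nmeet => f g fE gE; apply: contrapT => H2.
  by apply: H; exists f, g; split=> // x xf xg; apply: H2; exists x.
have [f1 [f2 [fE' _]]] := edgesP _ fE.
have f1f : f1 \in f by rewrite fE' in_edge eqxx.
have [z [zfg]] := reach_avoiding x0 g f1f.
wlog zg : f g fE gE dis zfg {f1 f2 fE' f1f} / z \in g.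
  move=> H; case: zfg => zfg; last by apply: (H f g) => //; right.
  move=> c; apply: (H g f) => //; [by move=> x xg xf; exact: dis xf xg|by right|].
  by apply: etrans c; apply: eq_connect => a b /=; rewrite (andbC (a \notin g)).
move=> cz.
pose S := (edges e :\ f)%SET.
have SE a b : edge a b \in S = (edge a b != f) && e a b by rewrite !inE mem_edges.
have {}cz : connect (step S) x0 z.
  apply: connect_sub cz => a b /and3P[eab af ag]; apply: connect1.
  rewrite /step SE eab andbT; apply: contraNneq af => <-.
  by rewrite in_edge eqxx.
have [v gE'] : exists v, g = edge z v.
  have /edgesP[p [q [gpq _]]] := gE.
  move: zg; rewrite gpq in_edge => /orP[]/eqP->; first by exists q.
  by exists p; rewrite edgeC.
have vg : v \in g by rewrite gE' in_edge eqxx orbT.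
have gS : edge z v \in S.
  rewrite SE -mem_edges -gE' gE andbT; apply/eqP => gf; apply: (dis z) => //.
  by rewrite -gf.
have cv : connect (step S) x0 v by apply: connect_trans cz _; apply: connect1.
pose E0 := [set h in S | [exists a, (a \in h) && connect (step S) x0 a]]%SET.
have E0E a b : connect (step S) x0 a -> edge a b \in S -> edge a b \in E0.
  move=> ca abS; rewrite inE abS; apply/existsP; exists a.
  by rewrite in_edge eqxx.
have E0S : E0 \subset S by apply/fintype.subsetP => h; rewrite inE => /andP[].
have sE : E0 \subset edges e.
  by apply: (fintype.subset_trans E0S); exact: finset.subD1set.
have sat u : connect (step S) x0 u -> u \notin f ->
    forall w, e u w -> edge u w \in E0.
  move=> cu uf w euw; apply: E0E => //; rewrite SE euw andbT.
  by apply: contraNneq uf => <-; rewrite in_edge eqxx.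
exists E0, z, v; split; last 3 first.
- exact: E0E.
- by apply: sat => //; apply/negP => zf; exact: dis zf zg.
- by apply: sat => //; apply/negP => vf; exact: dis vf vg.
split; last by move=> EE; move: fE; rewrite -EE !inE eqxx.
have tox0 u : u \in endpoints E0 -> connect (step E0) x0 u.
  have walk : forall p x, connect (step S) x0 x -> path (step S) x p ->
      connect (step E0) x (last x p).
    elim=> [|b p IH] x cx //= /andP[xb bp].
    apply: (connect_trans (connect1 (E0E x b cx xb : step E0 x b))).
    by apply: IH => //; apply: connect_trans cx _; apply: connect1.
  move=> /(endpointsP _ sE)[w uw].
  have uwS : edge u w \in S by exact: (fintype.subsetP E0S).
  have /connectP[p Sp ->] : connect (step S) x0 u.
    move: uw; rewrite inE => /andP[_ /existsP[a /andP[]]].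
    rewrite in_edge => /orP[]/eqP -> // cw; apply: connect_trans cw _.
    by apply: connect1; rewrite /step edgeC.
  exact: walk.
split=> //.
- move=> u w uE wE; apply: connect_trans (tox0 w wE).
  by rewrite (sym_connect_sym (@step_sym E0)) tox0.
- have /connectP[[|b p] /=] := cz.
    by move=> _ zx0; apply: (@endpoint_l E0 _ v); rewrite -zx0; exact: E0E.
  by move=> /andP[xb _] _; apply: (@endpoint_l E0 _ b); exact: E0E.
Qed.

End GraphFacts.

(** * The decay rate of one phase of the walk *)

Section Radius.
Variables (R : realType) (V : finType) (e : rel V).

Definition total_weight (delta : R) (E0 : {set {set V}}) (x : V) : R :=
  \sum_(z | e x z) weight delta E0 (edge x z).

(** The conductances of the edges in [E0]: the kernel [phat] restricted to these
    edges, multiplied by [total_weight] to make it symmetric. *)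
Definition inner_weight (delta : R) (E0 : {set {set V}}) (x y : V) : R :=
  delta * (edge x y \in E0)%:R.

Definition rayleigh (delta : R) (E0 : {set {set V}}) (g : V -> R) : R :=
  quad_form (inner_weight delta E0) g / diag_form (total_weight delta E0) g.

(** The spectral radius of [phat] killed on leaving [E0]. The killed kernel is
    self-adjoint with respect to [total_weight], so its largest eigenvalue is a
    supremum of Rayleigh quotients. *)
Definition radius (delta : R) (E0 : {set {set V}}) : R :=
  sup [set rayleigh delta E0 g | g in [set g | exists x, g x != 0]].

Hypotheses (e_sym : symmetric e) (e_irr : irreflexive e).
Hypotheses (e_conn : graph_connected e) (V_ge3 : (3 <= #|V|)%N).

Section FixedDelta.
Variable delta : R.
Hypothesis delta_gt0 : 0 < delta.

Lemma weight_gt0 E0 (f : {set V}) : 0 < weight delta E0 f.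
Proof. by rewrite /weight; case: ifP. Qed.

Lemma total_weight_ge E0 x y : e x y ->
  weight delta E0 (edge x y) <= total_weight delta E0 x.
Proof.
move=> exy; rewrite /total_weight (bigD1 y)//= lerDl sumr_ge0// => z _.
exact: ltW (weight_gt0 _ _).
Qed.

Lemma total_weight_gt0 E0 x : 0 < total_weight delta E0 x.
Proof.
have [y exy] := neighbor_ex e_conn V_ge3 x.
exact: lt_le_trans (weight_gt0 _ _) (total_weight_ge _ exy).
Qed.

Lemma inner_weight_sym E0 x y : inner_weight delta E0 x y = inner_weight delta E0 y x.
Proof. by rewrite /inner_weight edgeC. Qed.

Lemma inner_weight_ge0 E0 x y : 0 <= inner_weight delta E0 x y.
Proof. by rewrite mulr_ge0 ?ler0n// ltW. Qed.

Lemma phatE E0 x y : e x y ->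
  phat e delta E0 x y = weight delta E0 (edge x y) / total_weight delta E0 x.
Proof. by rewrite /phat => ->. Qed.

Lemma phat_ge0 E0 x y : 0 <= phat e delta E0 x y.
Proof.
have [exy|exy] := boolP (e x y); last by rewrite /phat (negPf exy).
by rewrite phatE// divr_ge0// ltW ?weight_gt0 ?total_weight_gt0.
Qed.

Lemma phat_gt0 E0 x y : e x y -> 0 < phat e delta E0 x y.
Proof. by move=> exy; rewrite phatE// divr_gt0 ?weight_gt0 ?total_weight_gt0. Qed.

Lemma phat_sum1 E0 x : \sum_y phat e delta E0 x y = 1.
Proof.
rewrite (bigID (e x))/= addrC big1 ?add0r; last first.
  by move=> y /negPf exy; rewrite /phat exy.
rewrite (eq_bigr (fun y => weight delta E0 (edge x y) / total_weight delta E0 x)).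
  by rewrite -mulr_suml divff// gt_eqF// total_weight_gt0.
by move=> y; exact: phatE.
Qed.

Lemma phat_in (E0 : {set {set V}}) x y : E0 \subset edges e -> edge x y \in E0 ->
  phat e delta E0 x y = delta / total_weight delta E0 x.
Proof.
move=> sE xyE; rewrite phatE; last exact: (edge_adjacent e_sym sE).
by rewrite /weight xyE.
Qed.

Lemma rayleighP E0 : exists2 h : V -> R,
  [/\ forall x, 0 <= h x, 0 < \sum_x h x &
      forall x, \sum_y inner_weight delta E0 x y * h y =
                radius delta E0 * (total_weight delta E0 x * h x)] &
  forall g x, g x != 0 -> rayleigh delta E0 g <= radius delta E0.
Proof.
have V0 : (0 < #|V|)%N by apply: leq_trans V_ge3.
have [rho [h [h0 hs hE hmax]]] :=
  perron (inner_weight_sym E0) (inner_weight_ge0 E0) (total_weight_gt0 E0) V0.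
have [x0 hx0] : exists x, h x != 0.
  apply: contrapT => /forallNP H; move: hs; rewrite big1 ?ltxx// => x _.
  by apply/eqP/negPn/negP; exact: H.
have le_rho g x : g x != 0 -> rayleigh delta E0 g <= rho.
  by move=> gx; rewrite ler_pdivrMr ?hmax// (diag_form_gt0 (total_weight_gt0 E0) gx).
have ubrho : ubound [set rayleigh delta E0 g | g in [set g | exists x, g x != 0]] rho.
  by move=> _ [g [x gx] <-]; exact: le_rho gx.
have rhoE : radius delta E0 = rho.
  apply/eqP; rewrite eq_le; apply/andP; split.
    by apply: ge_sup => //; exists (rayleigh delta E0 h), h => //; exists x0.
  have -> : rho = rayleigh delta E0 h.
    rewrite /rayleigh (_ : quad_form _ h = rho * diag_form (total_weight delta E0) h).
      by rewrite mulfK// gt_eqF// (diag_form_gt0 (total_weight_gt0 E0) hx0).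
    rewrite /quad_form /diag_form mulr_sumr; apply: eq_bigr => x _.
    under eq_bigr do rewrite mulrCA.
    by rewrite -mulr_sumr hE; ring.
  by apply: ub_le_sup; [exists rho|exists h => //; exists x0].
by exists h; rewrite rhoE.
Qed.

Lemma radius_ge E0 g x : g x != 0 -> rayleigh delta E0 g <= radius delta E0.
Proof. by have [h _] := rayleighP E0; apply. Qed.

Lemma radius_gt0 (E0 : {set {set V}}) x y : edge x y \in E0 -> 0 < radius delta E0.
Proof.
move=> xyE; have g1 : (fun=> 1 : R) x != 0 by rewrite oner_eq0.
apply: lt_le_trans (@radius_ge E0 (fun=> 1) x g1).
rewrite divr_gt0 ?(diag_form_gt0 (total_weight_gt0 E0) g1)// /quad_form.
have pos a z : 0 <= inner_weight delta E0 a z * (1 * 1).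
  by rewrite !mulr1 inner_weight_ge0.
rewrite (bigD1 x)//= (bigD1 y)//= -addrA ltr_pwDl//.
  by rewrite !mulr1 /inner_weight xyE mulr1.
by rewrite addr_ge0// sumr_ge0// => a _; rewrite sumr_ge0.
Qed.

Lemma radius_le E0 c : (forall g, (forall x, 0 <= g x) ->
    quad_form (inner_weight delta E0) g <= c * diag_form (total_weight delta E0) g) ->
  radius delta E0 <= c.
Proof.
move=> H; have V0 : (0 < #|V|)%N by apply: leq_trans V_ge3.
have [x0 _] := card_gt0P V0.
apply: ge_sup => [|_ [g [x gx] <-]].
  by exists (rayleigh delta E0 (fun=> 1)), (fun=> 1) => //; exists x0; rewrite oner_eq0.
rewrite ler_pdivrMr ?(diag_form_gt0 (total_weight_gt0 E0) gx)//.
apply: le_trans (quad_form_norm (inner_weight_ge0 E0) g) _.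
by rewrite -(diag_form_norm _ g); apply: H => y.
Qed.

(** Away from the endpoints of [E0] the eigenvalue equation has left side zero,
    which forces [h] to vanish there. A zero of [h] at an endpoint would spread to
    its neighbours in [E0], hence everywhere. *)
Lemma perron_vector x0 E0 : calS e x0 E0 -> exists h : V -> R,
  [/\ forall x, 0 <= h x, forall x, (0 < h x) = (x \in endpoints E0) &
      forall x, \sum_y inner_weight delta E0 x y * h y =
                radius delta E0 * (total_weight delta E0 x * h x)].
Proof.
move=> [sE cE x0E]; have [h [h0 hs hE] _] := rayleighP E0.
have [y0 x0y0] := endpointsP _ sE x0E.
have rho_gt0 : 0 < radius delta E0 by exact: radius_gt0 x0y0.
have out x : x \notin endpoints E0 -> h x = 0.
  move=> xE; have := hE x; rewrite big1; last first.
    move=> y _; rewrite /inner_weight (_ : _ \in E0 = false) ?mulr0 ?mul0r//.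
    by apply: contraNF xE; exact: endpoint_l.
  move/esym/eqP; rewrite mulf_eq0 gt_eqF//= mulf_eq0 gt_eqF ?total_weight_gt0//=.
  by move/eqP.
have spread x y : step E0 x y -> h x = 0 -> h y = 0.
  move=> xyE hx0; have := hE x; rewrite hx0 !mulr0 => /psumr_eq0P/(_ y).
  rewrite /inner_weight (_ : edge x y \in E0)// mulr1 => /(_ _ isT)/eqP.
  rewrite mulf_eq0 gt_eqF//= => H; apply/eqP/H => z _.
  by rewrite mulr_ge0 ?inner_weight_ge0.
exists h; split=> // x; apply/idP/idP => [hx|xE].
  by apply: contraTT hx => /out ->; rewrite ltxx.
rewrite lt_neqAle h0 andbT eq_sym; apply/eqP => hx0.
move: hs; rewrite big1 ?ltxx// => y _.
have [yE|/out//] := boolP (y \in endpoints E0).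
have /connectP[p ep ->] := cE x y xE yE.
elim: p x hx0 ep {xE} => //= b p IH x hx0 /andP[xb bp].
exact: (IH b (spread x b xb hx0) bp).
Qed.

Lemma perron_kernel (E0 : {set {set V}}) h x : E0 \subset edges e ->
  \sum_y inner_weight delta E0 x y * h y =
     radius delta E0 * (total_weight delta E0 x * h x) ->
  \sum_(y | edge x y \in E0) phat e delta E0 x y * h y = radius delta E0 * h x.
Proof.
move=> sE hE; have tw0 := total_weight_gt0 E0 x.
apply: (mulfI (negbT (gt_eqF tw0))); rewrite mulrCA -hE mulr_sumr.
rewrite [RHS](bigID (fun y => edge x y \in E0))/= [X in _ = _ + X]big1 ?addr0.
  apply: eq_bigr => y xyE; rewrite phat_in// /inner_weight xyE mulr1.
  by field; rewrite gt_eqF.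
by move=> y /negPf xyE; rewrite /inner_weight xyE mulr0 mul0r.
Qed.

End FixedDelta.
End Radius.

(** * The variational formula for the exponent *)

Section Variational.
Variables (R : realType) (V : finType) (e : rel V).
Hypotheses (e_sym : symmetric e) (e_irr : irreflexive e).
Hypotheses (e_conn : graph_connected e) (V_ge3 : (3 <= #|V|)%N).

Lemma rel_entropyE (m p : V -> R) : (forall y, 0 <= m y) ->
  (forall y, 0 < m y -> 0 < p y) ->
  rel_entropy m p = (\sum_y m y * ln (m y / p y))%:E.
Proof.
move=> m0 mp; rewrite /rel_entropy -sumEFin; apply: eq_bigr => y _.
case: eqP => [->|/eqP my]; first by rewrite mul0r.
by rewrite gt_eqF// mp// lt_neqAle eq_sym my m0.
Qed.

Section Admissible.
Variables (E0 : {set {set V}}) (q : V -> V -> R) (nu : V -> R).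
Hypotheses (sE : E0 \subset edges e) (qT : calT E0 q) (nu_prob : prob_vec nu).
Hypotheses (nu_stat : stationary E0 nu q).
Hypothesis nu_supp : forall x, nu x != 0 -> x \in endpoints E0.

Lemma entropy_costE delta : 0 < delta -> entropy_cost e delta E0 q nu =
  (\sum_(x in endpoints E0)
     nu x * \sum_y q x y * ln (q x y / phat e delta E0 x y))%:E.
Proof.
move=> d0; rewrite -sumEFin; apply: eq_bigr => x xE.
have [[q0 _] qE] := qT xE; rewrite rel_entropyE ?EFinM// => y /qE xyE.
by apply: phat_gt0 => //; exact: (edge_adjacent e_sym sE).
Qed.

(** Under a stationary law, the increments of a potential average to zero. *)
Lemma stationary_increment (phi : V -> R) c :
  \sum_(x in endpoints E0) nu x * \sum_y q x y * (phi y - phi x - c) = - c.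
Proof.
have [nu0 nu1] := nu_prob.
have nuE (f : V -> R) : \sum_(x in endpoints E0) nu x * f x = \sum_x nu x * f x.
  rewrite [RHS](bigID (fun x => x \in endpoints E0))/= [X in _ = _ + X]big1 ?addr0//.
  by move=> x xE; rewrite (contraNeq (@nu_supp x) xE) mul0r.
rewrite (eq_bigr (fun x => nu x * (\sum_y q x y * phi y) - nu x * (phi x + c))).
  rewrite sumrB.
  have -> : \sum_(x in endpoints E0) nu x * (\sum_y q x y * phi y) =
      \sum_x nu x * phi x.
    under eq_bigr do rewrite mulr_sumr.
    rewrite exchange_big /=; apply: eq_bigr => y _.
    by under eq_bigr do rewrite mulrA; rewrite -mulr_suml nu_stat.
  rewrite nuE; under [X in _ - X]eq_bigr do rewrite mulrDr.
  by rewrite big_split/= -mulr_suml nu1 mul1r opprD addrA subrr add0r.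
move=> x xE; have [[_ q1] _] := qT xE; rewrite -mulrBr; congr (_ * _).
rewrite (eq_bigr (fun y => q x y * phi y - q x y * (phi x + c))).
  by rewrite sumrB -mulr_suml q1 mul1r.
by move=> y _; ring.
Qed.

End Admissible.

Section FixedDelta.
Variable delta : R.
Hypothesis delta_gt0 : 0 < delta.

(** Gibbs inequality against the kernel of the Doob transform by the Perron
    vector; the remaining potential difference is averaged out by stationarity. *)
Lemma entropy_cost_ge x0 E0 q nu : calS e x0 E0 -> calT E0 q -> prob_vec nu ->
  stationary E0 nu q -> (forall x, nu x != 0 -> x \in endpoints E0) ->
  ((- ln (radius e delta E0))%:E <= entropy_cost e delta E0 q nu)%E.
Proof.
move=> SE qT nuP nuS nuE; have [sE _ x0E] := SE.
have [y0 x0y0] := endpointsP _ sE x0E.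
have rho0 := radius_gt0 e_conn V_ge3 delta_gt0 x0y0.
have [h [h0 hE hK]] := perron_vector e_conn V_ge3 delta_gt0 SE.
rewrite (entropy_costE nu sE qT delta_gt0) lee_fin.
rewrite -(stationary_increment qT nuP nuS nuE (fun x => ln (h x))).
apply: ler_sum => x xE; apply: ler_wpM2l; first by case: nuP.
rewrite -subr_ge0 -sumrB.
have hx : 0 < h x by rewrite hE.
have [[q0 q1] qE] := qT x xE.
pose r y := if edge x y \in E0 then
  phat e delta E0 x y * h y / (radius e delta E0 * h x) else 0.
have r1 : \sum_y r y = 1.
  rewrite /r -big_mkcond/= -mulr_suml perron_kernel//.
  by rewrite divff// gt_eqF// mulr_gt0.
apply: (@le_trans _ _ (\sum_y (q x y - r y))); first by rewrite sumrB q1 r1 subrr.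
apply: ler_sum => y _; rewrite -mulrBr.
have [qy|qy] := ltP 0 (q x y); last first.
  have -> : q x y = 0 by apply/eqP; rewrite eq_le qy q0.
  rewrite mul0r sub0r oppr_le0 /r; case: ifP => // xyE.
  by rewrite divr_ge0 ?mulr_ge0 ?phat_ge0// ltW.
have xyE := qE _ qy; have hy : 0 < h y by rewrite hE (endpoint_r xyE).
have p0 : 0 < phat e delta E0 x y.
  by apply: phat_gt0 => //; exact: (edge_adjacent e_sym sE).
have ry : 0 < r y by rewrite /r xyE divr_gt0 ?mulr_gt0.
have -> : ln (q x y / phat e delta E0 x y) -
    (ln (h y) - ln (h x) - ln (radius e delta E0)) = - ln (r y / q x y).
  rewrite /r xyE !ln_div ?posrE ?divr_gt0 ?mulr_gt0// !lnM ?posrE//; ring.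
have := @le_ln1Dx R (r y / q x y - 1); rewrite subrKC.
have rq : 0 < r y / q x y by rewrite divr_gt0.
have -> : -1 < r y / q x y - 1 by lra.
move=> /(_ isT) H; rewrite -lerN2 -mulrN opprK.
apply: (le_trans (ler_wpM2l (q0 y) H)).
by rewrite mulrBr mulr1 mulrCA divff ?gt_eqF// mulr1 opprB.
Qed.

(** The Doob transform by the Perron vector, with its reversible law, is
    optimal. *)
Lemma entropy_cost_attained x0 E0 : calS e x0 E0 -> exists q nu,
  [/\ calT E0 q, prob_vec nu, stationary E0 nu q,
      forall x, nu x != 0 -> x \in endpoints E0 &
      entropy_cost e delta E0 q nu = (- ln (radius e delta E0))%:E].
Proof.
move=> SE; have [sE _ x0E] := SE.
have [y0 x0y0] := endpointsP _ sE x0E.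
have rho0 := radius_gt0 e_conn V_ge3 delta_gt0 x0y0.
have [h [h0 hE hK]] := perron_vector e_conn V_ge3 delta_gt0 SE.
have tw0 x := total_weight_gt0 e_conn V_ge3 delta_gt0 E0 x.
set rho := radius e delta E0 in rho0 *; set tw := total_weight e delta E0 in tw0 *.
pose q x y := if edge x y \in E0 then
  phat e delta E0 x y * h y / (rho * h x) else 0.
pose N := diag_form tw h.
have N0 : 0 < N.
  apply: (@diag_form_gt0 R V tw tw0 h x0); rewrite gt_eqF// hE//.
pose nu x := tw x * h x ^+ 2 / N.
have qE x y : edge x y \in E0 ->
    [/\ 0 < h x, 0 < h y, 0 < phat e delta E0 x y & 0 < q x y].
  move=> xyE; have hx : 0 < h x by rewrite hE (endpoint_l xyE).
  have hy : 0 < h y by rewrite hE (endpoint_r xyE).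
  have p0 : 0 < phat e delta E0 x y.
    by apply: phat_gt0 => //; exact: (edge_adjacent e_sym sE).
  by split=> //; rewrite /q xyE divr_gt0 ?mulr_gt0.
have qT : calT E0 q.
  move=> x xE; have hx : 0 < h x by rewrite hE.
  split; last by move=> y; rewrite /q; case: ifP => //; rewrite ltxx.
  split=> [y|].
    have [xyE|xyE] := boolP (edge x y \in E0); first by have [_ _ _ /ltW] := qE x y xyE.
    by rewrite /q (negPf xyE).
  rewrite /q -big_mkcond/= -mulr_suml perron_kernel//.
  by rewrite divff// gt_eqF// mulr_gt0.
have nuP : prob_vec nu.
  split=> [x|]; first by rewrite divr_ge0 ?mulr_ge0 ?sqr_ge0// ltW.
  by rewrite -mulr_suml divff// gt_eqF.
have nuE x : nu x != 0 -> x \in endpoints E0.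
  apply: contraNT; rewrite -hE lt_neqAle h0 andbT negbK eq_sym => /eqP hx.
  by rewrite /nu hx expr0n mulr0 mul0r.
have nuS : stationary E0 nu q.
  move=> y; rewrite /nu.
  transitivity (h y / (N * rho) * \sum_x inner_weight delta E0 y x * h x).
    rewrite mulr_sumr [RHS](bigID (fun x => x \in endpoints E0))/=.
    rewrite [X in _ = _ + X]big1 ?addr0; last first.
      move=> x xE; rewrite /inner_weight (_ : _ \in E0 = false) ?mulr0 ?mul0r ?mulr0//.
      by apply: contraNF xE; exact: endpoint_r.
    apply: eq_bigr => x xE; rewrite /inner_weight /q edgeC.
    have hx : h x != 0 by rewrite gt_eqF// hE.
    case: ifP => [xyE|_]; last by rewrite !(mulr0, mul0r).
    have xyE' : edge x y \in E0 by rewrite edgeC.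
    rewrite phat_in// -/tw mulr1; field.
    by rewrite hx !gt_eqF.
  by rewrite hK -/rho -/tw; field; rewrite !gt_eqF.
exists q, nu; split => //.
rewrite (entropy_costE nu sE qT delta_gt0); congr EFin.
rewrite -(stationary_increment qT nuP nuS nuE (fun x => ln (h x))).
apply: eq_bigr => x xE; congr (_ * _); apply: eq_bigr => y _.
have [xyE|xyE] := boolP (edge x y \in E0); last by rewrite /q (negPf xyE) !mul0r.
have [hx hy p0 _] := qE x y xyE; congr (_ * _).
have -> : q x y / phat e delta E0 x y = h y / (h x * rho).
  by rewrite /q xyE; field; rewrite !gt_eqF.
by rewrite ln_div ?lnM ?posrE ?mulr_gt0// opprD addrA.
Qed.

(** The infimum over kernels and laws is a minimum for each edge set, and there
    are finitely many edge sets. *)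
Lemma alpha_c1E x0 : exists E0,
  [/\ calS1 e x0 E0, alpha_c1 e x0 delta = (- ln (radius e delta E0))%:E &
      forall E1, calS1 e x0 E1 -> radius e delta E1 <= radius e delta E0].
Proof.
have [E1 E1S] : exists E1, calS1 e x0 E1.
  have [y exy] := neighbor_ex e_conn V_ge3 x0.
  by exists [set edge x0 y]%SET; exact: calS1_edge.
have PE1 : `[< calS1 e x0 E1 >] by exact/asboolP.
have [E0 /asboolP E0S E0max] := @Order.TotalTheory.arg_maxP _ _ _ E1
  (fun E => `[< calS1 e x0 E >]) (radius e delta) PE1.
have {}E0max E : calS1 e x0 E -> radius e delta E <= radius e delta E0.
  by move=> ES; apply: E0max; exact/asboolP.
have rho_gt0 E : calS1 e x0 E -> 0 < radius e delta E.
  move=> [[sE _ xE] _]; have [y xy] := endpointsP _ sE xE.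
  exact: (radius_gt0 e_conn V_ge3 delta_gt0 xy).
exists E0; split=> //; apply/eqP; rewrite eq_le; apply/andP; split.
  have [q [nu [qT nuP nuS nuE <-]]] := entropy_cost_attained E0S.1.
  by apply: ereal_inf_lbound; exists E0, q, nu.
apply: le_ereal_inf_tmp => _ [E [q [nu [ES qT [nuP nuS] nuE ->]]]].
apply: le_trans (entropy_cost_ge ES.1 qT nuP nuS nuE).
rewrite lee_fin lerN2 ler_ln ?posrE ?rho_gt0//; exact: E0max.
Qed.

End FixedDelta.
End Variational.

(** * Monotonicity and bounds of the decay rate *)

Section RadiusEstimates.
Variables (R : realType) (V : finType) (e : rel V).
Hypotheses (e_sym : symmetric e) (e_irr : irreflexive e).
Hypotheses (e_conn : graph_connected e) (V_ge3 : (3 <= #|V|)%N).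
Implicit Types (s t delta : R) (E : {set {set V}}).

Lemma radius_rayleigh x0 delta (E0 : {set {set V}}) : 0 < delta -> calS e x0 E0 ->
  exists h : V -> R, [/\ forall x, 0 <= h x,
    forall x, (0 < h x) = (x \in endpoints E0) &
    radius e delta E0 = rayleigh e delta E0 h].
Proof.
move=> d0 SE; have [h [h0 hE hK]] := perron_vector e_conn V_ge3 d0 SE.
exists h; split => //; have [_ _ x0E] := SE.
have tw0 := total_weight_gt0 e_conn V_ge3 d0 E0.
have N0 : 0 < diag_form (total_weight e delta E0) h.
  by apply: (diag_form_gt0 tw0 (x := x0)); rewrite gt_eqF// hE.
apply: (canRL (mulfK (negbT (gt_eqF N0)))).
rewrite mulr_sumr; apply: eq_bigr => x _.
under eq_bigr do rewrite mulrCA.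
by rewrite -mulr_sumr hK; ring.
Qed.

Lemma quad_form_inner delta E0 (g : V -> R) :
  quad_form (inner_weight delta E0) g = delta * quad_form (inner_weight 1 E0) g.
Proof.
rewrite /quad_form mulr_sumr; apply: eq_bigr => x _; rewrite mulr_sumr.
by apply: eq_bigr => y _; rewrite /inner_weight; ring.
Qed.

Lemma total_weight_le s t (E0 : {set {set V}}) x : s <= t ->
  total_weight e s E0 x <= total_weight e t E0 x.
Proof. by move=> st; apply: ler_sum => z _; rewrite /weight; case: ifP. Qed.

(** Edges outside [E0] lose weight relative to the others as [delta] grows. *)
Lemma total_weight_rescale s t (E0 : {set {set V}}) x : 0 <= s <= t ->
  s * total_weight e t E0 x <= t * total_weight e s E0 x.
Proof.
move=> /andP[s0 st]; rewrite !mulr_sumr; apply: ler_sum => z _.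
by rewrite /weight; case: ifP => _; rewrite ?mulr1// mulrC.
Qed.

Lemma total_weight_rescale_lt s t (E0 : {set {set V}}) x y : 0 <= s < t -> e x y ->
  edge x y \notin E0 -> s * total_weight e t E0 x < t * total_weight e s E0 x.
Proof.
move=> /andP[s0 st] exy xyE; rewrite !mulr_sumr (bigD1 y)//= [ltRHS](bigD1 y)//=.
rewrite ltr_leD//; first by rewrite /weight (negPf xyE) !mulr1.
apply: ler_sum => z _.
by rewrite /weight; case: ifP => _; rewrite ?mulr1 ?(ltW st)// mulrC.
Qed.

(** The Perron vector at [s] is a test function at [t]. It charges a vertex with
    an edge outside [E0], where the ratio of [total_weight] to [delta] is smaller
    at [t] than at [s]. *)
Lemma radius_increasing x0 s t E0 : calS1 e x0 E0 -> 0 < s -> s < t ->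
  radius e s E0 < radius e t E0.
Proof.
move=> S1E s0 st; have t0 := lt_trans s0 st.
have [a [b [aE eab abE]]] := unsaturated_ex e_conn S1E.
have [h [h0 hE rhoE]] := radius_rayleigh s0 S1E.1; rewrite rhoE.
have ha : 0 < h a by rewrite hE.
apply: lt_le_trans (radius_ge e_conn V_ge3 t0 E0 (negbT (gt_eqF ha))).
have N0 r : 0 < r -> 0 < diag_form (total_weight e r E0) h.
  move=> r0; apply: (diag_form_gt0 (total_weight_gt0 e_conn V_ge3 r0 E0) (x := a)).
  by rewrite gt_eqF.
rewrite /rayleigh (quad_form_inner s) (quad_form_inner t).
have B0 : 0 < quad_form (inner_weight 1 E0) h.
  have [sE _ _] := S1E.1; have [c ac] := endpointsP _ sE aE.
  have := radius_gt0 e_conn V_ge3 s0 ac; rewrite rhoE /rayleigh quad_form_inner.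
  by rewrite pmulr_lgt0 ?invr_gt0 ?N0// pmulr_rgt0.
rewrite ltr_pdivrMr ?N0// mulrAC ltr_pdivlMr ?N0// -!mulrA.
rewrite [ltLHS]mulrCA [ltRHS]mulrCA ltr_pM2l//.
rewrite /diag_form !mulr_sumr (bigD1 a)//= [ltRHS](bigD1 a)//=.
apply: ltr_leD.
  rewrite mulrA [ltRHS]mulrA ltr_pM2r ?exprn_gt0//.
  by apply: total_weight_rescale_lt eab abE; rewrite ltW.
apply: ler_sum => x _; rewrite mulrA [leRHS]mulrA ler_wpM2r ?sqr_ge0//.
by apply: total_weight_rescale; rewrite !ltW.
Qed.

(** Total weights increase with [delta], so passing from [t] to [s] with the
    Perron vector at [t] as test function costs at most the factor [s / t]. *)
Lemma radius_rescale x0 s t E0 : calS e x0 E0 -> 0 < s -> s <= t ->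
  s / t * radius e t E0 <= radius e s E0.
Proof.
move=> SE s0 st; have t0 := lt_le_trans s0 st.
have [h [h0 hE ->]] := radius_rayleigh t0 SE; have [_ _ x0E] := SE.
have hx : h x0 != 0 by rewrite gt_eqF// hE.
apply: le_trans (radius_ge e_conn V_ge3 s0 E0 hx).
have N0 r : 0 < r -> 0 < diag_form (total_weight e r E0) h.
  by move=> r0; exact: (diag_form_gt0 (total_weight_gt0 e_conn V_ge3 r0 E0) hx).
have B0 : 0 <= quad_form (inner_weight 1 E0) h.
  do 2 (apply: sumr_ge0 => ? _).
  by rewrite mulr_ge0 ?mulr_ge0 ?inner_weight_ge0.
rewrite /rayleigh (quad_form_inner s) (quad_form_inner t) mulrA mulrA divfK ?gt_eqF//.
rewrite ler_wpM2l ?(mulr_ge0 (ltW s0))// lef_pV2 ?posrE ?N0//.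
by apply: ler_sum => x _; rewrite ler_wpM2r ?sqr_ge0// total_weight_le.
Qed.

(** Twice [g x * g y] is at most [g x ^+ 2 + g y ^+ 2], and the conductances of
    the edges of [E0] at [x] add up to at most [total_weight] there. *)
Lemma radius_le1 delta (E0 : {set {set V}}) : 0 < delta ->
  E0 \subset edges e -> radius e delta E0 <= 1.
Proof.
move=> d0 sE; apply: radius_le => // g g0; rewrite mul1r.
pose a x y := inner_weight delta E0 x y.
have deg x : \sum_y a x y <= total_weight e delta E0 x.
  rewrite /total_weight (bigID (e x))/= [X in _ + X]big1 ?addr0.
    apply: ler_sum => y _; rewrite /a /inner_weight /weight.
    by case: ifP => _; rewrite ?mulr1 ?mulr0.
  move=> y nxy; rewrite /a /inner_weight (_ : _ \in E0 = false) ?mulr0//.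
  by apply: contraNF nxy; exact: (edge_adjacent e_sym sE).
have sumx : \sum_x \sum_y a x y * g x ^+ 2 <= diag_form (total_weight e delta E0) g.
  by apply: ler_sum => x _; rewrite -mulr_suml ler_wpM2r ?sqr_ge0.
have sumy : \sum_x \sum_y a x y * g y ^+ 2 <= diag_form (total_weight e delta E0) g.
  rewrite exchange_big/=; apply: le_trans sumx; apply: ler_sum => x _.
  by apply: ler_sum => y _; rewrite /a inner_weight_sym.
rewrite -(ler_pM2l (ltr0n R 2)).
apply: (@le_trans _ _
  (\sum_x \sum_y a x y * g x ^+ 2 + \sum_x \sum_y a x y * g y ^+ 2)).
  rewrite -big_split /quad_form mulr_sumr/=; apply: ler_sum => x _.
  rewrite -big_split mulr_sumr/=; apply: ler_sum => y _.
  rewrite -mulrDr mulrCA ler_wpM2l ?inner_weight_ge0//.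
  by have := sqr_ge0 (g x - g y); rewrite sqrrB; nra.
by rewrite mulr_natl mulr2n lerD.
Qed.

(** Test function: the indicator of [u] and [v]. *)
Lemma radius_ge_pair delta (E0 : {set {set V}}) u v c :
  0 < delta -> e u v -> edge u v \in E0 ->
  total_weight e delta E0 u <= c -> total_weight e delta E0 v <= c ->
  delta / c <= radius e delta E0.
Proof.
move=> d0 euv uvE uc vc.
have uv : u != v by apply: contraTneq euv => ->; rewrite e_irr.
have vu : v != u by rewrite eq_sym.
have tw0 := total_weight_gt0 e_conn V_ge3 d0 E0.
pose g x : R := (x \in edge u v)%:R.
have gu : g u = 1 by rewrite /g in_edge eqxx.
have gv : g v = 1 by rewrite /g in_edge eqxx orbT.
have gu0 : g u != 0 by rewrite gu oner_eq0.
apply: le_trans (radius_ge e_conn V_ge3 d0 E0 gu0).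
have pos x y : 0 <= inner_weight delta E0 x y * (g x * g y).
  by rewrite mulr_ge0 ?inner_weight_ge0// mulr_ge0 /g ?ler0n.
have c0 : 0 < c := lt_le_trans (tw0 u) uc.
rewrite ler_pdivlMr ?(diag_form_gt0 tw0 gu0)// mulrAC ler_pdivrMr//.
have B : 2 * delta <= quad_form (inner_weight delta E0) g.
  have row x y : g x = 1 -> g y = 1 -> edge x y \in E0 ->
      delta <= \sum_z inner_weight delta E0 x z * (g x * g z).
    move=> gx gy xyE; rewrite (bigD1 y)//= gx gy /inner_weight xyE !mulr1 lerDl.
    by apply: sumr_ge0 => z _; have := pos x z; rewrite gx.
  rewrite /quad_form (bigD1 u)//= [X in _ <= _ + X](bigD1 v)//= addrA.
  rewrite -[2 * _]addr0 mulr_natl mulr2n.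
  apply: lerD; first by rewrite lerD ?(row u v) ?(row v u) ?(edgeC v u).
  by apply: sumr_ge0 => x _; apply: sumr_ge0.
have N : diag_form (total_weight e delta E0) g <= 2 * c.
  rewrite /diag_form (bigD1 u)//= (bigD1 v)//= gu gv !expr1n !mulr1 big1 ?addr0; first lra.
  by move=> x /andP[xu xv]; rewrite /g in_edge (negPf xu) (negPf xv) expr0n mulr0.
have := ler_wpM2l (ltW d0) N; have := ler_wpM2r (ltW c0) B; nra.
Qed.

(** Every edge [xy] of [E0] meets a fixed edge outside [E0], say at [x]; then the
    total weight is at least [1] at [x] and at least [delta] at [y], and the
    inequality of the two means bounds the contribution of [xy] by
    [Num.sqrt delta] times the average of the two diagonal terms. *)
Lemma radius_le_sqrt x0 delta (E0 : {set {set V}}) :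
  edges_meet e -> 0 < delta -> calS1 e x0 E0 ->
  radius e delta E0 <= #|V|%:R * Num.sqrt delta.
Proof.
move=> meet d0 [[sE _ _] neE].
have [f [fE fE0]] : exists f, f \in edges e /\ f \notin E0.
  apply: contrapT => H; apply: neE; apply/eqP; rewrite finset.eqEsubset sE /=.
  by apply/fintype.subsetP => f fE; apply/negPn/negP => fE0; apply: H; exists f.
have unsat x y : edge x y \in E0 -> x \in f -> 
    1 <= total_weight e delta E0 x /\ delta <= total_weight e delta E0 y.
  move=> xyE xf.
  have [w fxw] : exists w, f = edge x w.
    have /edgesP[p [q [fpq _]]] := fE.
    move: xf; rewrite fpq in_edge => /orP[]/eqP->; first by exists q.
    by exists p; rewrite edgeC.
  have exw : e x w by rewrite -mem_edges// -fxw.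
  have eyx : e y x by rewrite e_sym; exact: (edge_adjacent e_sym sE).
  split; [have := total_weight_ge d0 E0 exw|have := total_weight_ge d0 E0 eyx].
    by rewrite /weight -fxw (negPf fE0).
  by rewrite /weight edgeC xyE.
set r := Num.sqrt delta; have r0 : 0 < r by rewrite sqrtr_gt0.
have r2 : r ^+ 2 = delta by rewrite sqr_sqrtr// ltW.
apply: radius_le => // g g0.
have tw0 x := ltW (total_weight_gt0 e_conn V_ge3 d0 E0 x).
pose m x := total_weight e delta E0 x * g x ^+ 2.
have m0 x : 0 <= m x by rewrite mulr_ge0 ?sqr_ge0.
have bnd x y : inner_weight delta E0 x y * (g x * g y) <= r / 2 * (m x + m y).
  rewrite /inner_weight; case: (boolP (edge x y \in E0)) => [xyE|_]; last first.
    by rewrite mulr0 mul0r mulr_ge0 ?addr_ge0// divr_ge0// ltW.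
  wlog xf : x y xyE / x \in f.
    move=> H; have [z [zf]] := meet _ _ fE (fintype.subsetP sE _ xyE).
    rewrite in_edge => /orP[]/eqP zE; subst z; first exact: H.
    by rewrite (mulrC (g x)) (addrC (m x)); apply: H; rewrite // edgeC.
  have [twx twy] := unsat _ _ xyE xf.
  have hx : g x ^+ 2 <= m x by rewrite ler_peMl ?sqr_ge0.
  have hy : r ^+ 2 * g y ^+ 2 <= m y by rewrite r2 ler_wpM2r ?sqr_ge0.
  rewrite mulr1 -r2.
  have H : 2 * (r * (g x * g y)) <= m x + m y.
    apply: le_trans (lerD hx hy); rewrite -subr_ge0.
    have -> : g x ^+ 2 + r ^+ 2 * g y ^+ 2 - 2 * (r * (g x * g y)) =
        (g x - r * g y) ^+ 2 by ring.
    exact: sqr_ge0.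
  have -> : r ^+ 2 * (g x * g y) = r / 2 * (2 * (r * (g x * g y))) by field.
  by rewrite ler_pM2l// divr_gt0.
apply: (@le_trans _ _ (\sum_(x : V) \sum_(y : V) r / 2 * (m x + m y))).
  by apply: ler_sum => x _; apply: ler_sum => y _.
rewrite le_eqVlt; apply/orP; left; apply/eqP.
have -> : diag_form (total_weight e delta E0) g = \sum_x m x by [].
under eq_bigr do rewrite -mulr_sumr big_split/= sumr_const.
rewrite -mulr_sumr big_split/= sumrMnl sumr_const.
set M := \sum_x m x; by rewrite -(mulr_natl M); field.
Qed.

End RadiusEstimates.

(** * Regularity and limits of the exponent *)

Section Exponent.
Variables (R : realType) (V : finType) (e : rel V) (x0 : V).
Hypotheses (e_sym : symmetric e) (e_irr : irreflexive e).
Hypotheses (e_conn : graph_connected e) (V_ge3 : (3 <= #|V|)%N).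
Implicit Types (s t delta : R).

Definition exponent delta : R := fine (alpha_c1 e x0 delta).

Lemma exponentP delta : 0 < delta -> exists E0,
  [/\ calS1 e x0 E0, exponent delta = - ln (radius e delta E0) &
      forall E1, calS1 e x0 E1 -> radius e delta E1 <= radius e delta E0].
Proof.
move=> d0; have [E0 [S1 aE m]] := alpha_c1E e_sym e_conn V_ge3 d0 x0.
by exists E0; split=> //; rewrite /exponent aE.
Qed.

Lemma calS1_radius_gt0 delta E0 : 0 < delta -> calS1 e x0 E0 ->
  0 < radius e delta E0.
Proof.
move=> d0 [[sE _ xE] _]; have [y xy] := endpointsP _ sE xE.
exact: (radius_gt0 e_conn V_ge3 d0 xy).
Qed.

Lemma exponent_le delta E0 : 0 < delta -> calS1 e x0 E0 ->
  exponent delta <= - ln (radius e delta E0).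
Proof.
move=> d0 ES; have [E1 [E1S -> E1max]] := exponentP d0.
by rewrite lerN2 ler_ln ?posrE ?calS1_radius_gt0 ?E1max.
Qed.

Lemma exponent_ge0 delta : 0 < delta -> 0 <= exponent delta.
Proof.
move=> d0; have [E0 [[[sE _ _] _] -> _]] := exponentP d0.
by rewrite oppr_ge0 ln_le0// radius_le1.
Qed.

Lemma exponent_decreasing s t : 0 < s -> s < t -> exponent t < exponent s.
Proof.
move=> s0 st; have t0 := lt_trans s0 st.
have [E0 [ES -> _]] := exponentP s0.
apply: le_lt_trans (exponent_le t0 ES) _.
rewrite ltrN2 ltr_ln ?posrE ?calS1_radius_gt0//.
exact: (radius_increasing e_conn V_ge3 ES).
Qed.

Lemma exponent_gt0 delta : 0 < delta -> 0 < exponent delta.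
Proof.
move=> d0; apply: (@le_lt_trans _ _ (exponent (delta + 1))).
  by rewrite exponent_ge0// addr_gt0.
by rewrite exponent_decreasing// ltrDl.
Qed.

(** At the logarithmic scale the exponent is Lipschitz with constant one; this
    yields both continuity and uniform continuity away from zero. *)
Lemma exponent_log_lipschitz s t : 0 < s -> s <= t ->
  0 <= exponent s - exponent t <= ln t - ln s.
Proof.
move=> s0 st; have t0 := lt_le_trans s0 st; rewrite subr_ge0; apply/andP; split.
  by move: st; rewrite le_eqVlt => /orP[/eqP->//|st]; exact/ltW/exponent_decreasing.
have [E0 [ES -> _]] := exponentP t0.
have := radius_rescale e_conn V_ge3 ES.1 s0 st.
have rt := calS1_radius_gt0 t0 ES; have rs := calS1_radius_gt0 s0 ES.
rewrite -ler_ln ?posrE ?mulr_gt0 ?invr_gt0// lnM ?posrE ?divr_gt0//.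
rewrite ln_div ?posrE// => H; have := exponent_le s0 ES; lra.
Qed.

Lemma exponent_log_dist s t : 0 < s -> 0 < t ->
  `|exponent s - exponent t| <= `|ln s - ln t|.
Proof.
wlog st : s t / s <= t.
  move=> H s0 t0; have [st|/ltW ts] := leP s t; first exact: H.
  by rewrite distrC (distrC (ln s)); exact: H.
move=> s0 t0; have /andP[H1 H2] := exponent_log_lipschitz s0 st.
by rewrite ger0_norm// distrC ger0_norm// (le_trans H1).
Qed.

Lemma exponent_continuous delta : 0 < delta -> {for delta, continuous exponent}.
Proof.
move=> d0; apply/cvgrPdist_lt => eps eps0.
have /cvgrPdist_lt/(_ _ eps0) := @continuous_ln R _ d0.
move=> lnc; near=> t.
have t0 : 0 < t by near: t; exact: lt_nbhsr.
apply: le_lt_trans (exponent_log_dist d0 t0) _.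
by near: t.
Unshelve. all: by end_near. Qed.

Lemma exponent_uniform delta0 eps : 0 < delta0 -> 0 < eps ->
  exists2 eta : R, 0 < eta & forall s t, delta0 <= s -> delta0 <= t ->
    `|s - t| < eta -> `|exponent s - exponent t| < eps.
Proof.
move=> d0 eps0; exists (eps * delta0); first by rewrite mulr_gt0.
move=> s t; wlog st : s t / s <= t.
  move=> H ds dt; have [st|/ltW ts] := leP s t; first exact: H.
  by rewrite distrC (distrC (exponent s)); exact: H.
move=> ds dt; have s0 := lt_le_trans d0 ds; have t0 := lt_le_trans d0 dt.
rewrite distrC ger0_norm ?subr_ge0// => tseta.
have /andP[H1 H2] := exponent_log_lipschitz s0 st.
rewrite ger0_norm//; apply: le_lt_trans H2 _.
rewrite -ln_div ?posrE//; have := @le_ln1Dx R (t / s - 1); rewrite subrKC.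
have ts : 0 < t / s by rewrite divr_gt0.
have -> : -1 < t / s - 1 by lra.
move=> /(_ isT) /le_lt_trans; apply.
have -> : t / s - 1 = (t - s) / s by field; rewrite gt_eqF.
rewrite ltr_pdivrMr//; apply: lt_le_trans tseta _.
by rewrite ler_wpM2l// ltW.
Qed.

(** For a large [delta] the walk crosses its first edge back and forth for a long
    time: the single edge [x0 y] already has a decay rate close to one. *)
Lemma exponent_cvg_pinfty : exponent delta @[delta --> +oo] --> (0 : R).
Proof.
have [y exy] := neighbor_ex e_conn V_ge3 x0.
set n : R := #|V|%:R.
have n0 : 0 < n by rewrite ltr0n (ltnW (ltnW V_ge3)).
have yx : y != x0 by apply: contraTneq exy => ->; rewrite e_irr.
have tw delta a b : 0 < delta -> edge a b = edge x0 y ->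
    total_weight e delta [set edge x0 y]%SET a <= delta + n.
  move=> d0 ab; rewrite /total_weight.
  apply: (@le_trans _ _ (\sum_(z | e a z) ((z == b)%:R * delta + 1))).
    apply: ler_sum => z _; rewrite /weight inE -ab.
    case: eqP => [/edge_inj->|_]; first by rewrite eqxx mul1r lerDl.
    by rewrite lerDr mulr_ge0 ?ler0n// ltW.
  apply: (@le_trans _ _ (\sum_z ((z == b)%:R * delta + 1))).
    rewrite [leRHS](bigID (e a))/= lerDl sumr_ge0// => z _.
    by rewrite addr_ge0 ?mulr_ge0 ?ler0n// ltW.
  rewrite big_split/= (bigD1 b)//= eqxx mul1r big1 ?addr0; last first.
    by move=> z /negPf->; rewrite mul0r.
  by rewrite sumr_const cardT -cardE.
have bound delta : 0 < delta -> exponent delta <= n / delta.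
  move=> d0; have ES : calS1 e x0 [set edge x0 y]%SET.
    exact: calS1_edge.
  apply: (le_trans (exponent_le d0 ES)).
  have xyE : edge x0 y \in [set edge x0 y]%SET by rewrite inE.
  have := radius_ge_pair e_irr e_conn V_ge3 d0 exy xyE (tw _ _ y d0 erefl)
    (tw _ _ x0 d0 (edgeC _ _)).
  have dn0 : 0 < delta + n by rewrite addr_gt0.
  have dd0 : 0 < delta / (delta + n) by rewrite divr_gt0.
  rewrite -ler_ln ?posrE ?calS1_radius_gt0// -lerN2 => /le_trans; apply.
  rewrite -lnV ?posrE// invf_div.
  have -> : (delta + n) / delta = 1 + n / delta by field; rewrite gt_eqF.
  by apply: le_ln1Dx; apply: (@lt_trans _ _ 0) => //; rewrite divr_gt0.
apply/cvgrPdist_lt => eps eps0; near=> delta.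
have d0 : 0 < delta by near: delta; exact: nbhs_pinfty_gt.
rewrite sub0r normrN ger0_norm ?exponent_ge0//.
apply: le_lt_trans (bound _ d0) _; rewrite ltr_pdivrMr// -ltr_pdivrMl//.
by near: delta; apply: nbhs_pinfty_gt; exact: num_real.
Unshelve. all: by end_near. Qed.

Lemma exponent_cvg0_pinfty : edges_meet e ->
  exponent delta @[delta --> 0^'+] --> +oo.
Proof.
move=> meet; apply/cvgryPge => A.
set n : R := #|V|%:R.
have n0 : 0 < n by rewrite ltr0n (ltnW (ltnW V_ge3)).
have r0 : 0 < (expR (- A) / n) ^+ 2 by rewrite exprn_gt0// divr_gt0// expR_gt0.
near=> delta.
have d0 : 0 < delta by near: delta; exact: nbhs_right_gt.
have [E0 [ES -> _]] := exponentP d0.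
rewrite lerNr -ler_expR lnK ?posrE ?calS1_radius_gt0//.
apply: le_trans (radius_le_sqrt e_sym e_conn V_ge3 meet d0 ES) _.
rewrite -/n -ler_pdivlMl// mulrC -[leRHS]ger0_norm; last first.
  by rewrite divr_ge0// ?expR_ge0// ltW.
rewrite -sqrtr_sqr ler_sqrt; last exact: ltW.
by apply: ltW; near: delta; exact: nbhs_right_lt.
Unshelve. all: by end_near. Qed.

(** On an edge all of whose neighbouring edges are covered, the walk is simple
    random walk whatever [delta]. The rate of that phase bounds the exponent, which
    converges because it is monotone. *)
Lemma exponent_cvg0_finite : ~ edges_meet e ->
  exists l : R, exponent delta @[delta --> 0^'+] --> l.
Proof.
move=> /(saturated_edge_ex e_sym e_conn x0)[E0 [u [v [ES uvE usat vsat]]]].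
have [[sE _ _] _] := ES.
have euv := edge_adjacent e_sym sE uvE.
set n : R := #|V|%:R.
have n0 : 0 < n by rewrite ltr0n (ltnW (ltnW V_ge3)).
have tw delta a : 0 < delta -> (forall z, e a z -> edge a z \in E0) ->
    total_weight e delta E0 a <= n * delta.
  move=> d0 sat; rewrite /total_weight.
  rewrite (eq_bigr (fun=> delta)); last by move=> z /sat; rewrite /weight => ->.
  rewrite sumr_const -[leLHS]mulr_natl; apply: ler_wpM2r; first exact: ltW.
  by rewrite ler_nat; exact: max_card.
have bound delta : 0 < delta -> exponent delta <= ln n.
  move=> d0; apply: (le_trans (exponent_le d0 ES)).
  rewrite -[leRHS]opprK lerN2 -lnV ?posrE// ler_ln ?posrE ?invr_gt0 ?calS1_radius_gt0//.
  have := radius_ge_pair e_irr e_conn V_ge3 d0 euv uvE (tw _ _ d0 usat) (tw _ _ d0 vsat).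
  by rewrite invfM mulrCA divff ?mulr1// gt_eqF.
pose S := exponent @` [set delta | 0 < delta].
have S_ub : has_ubound S by exists (ln n) => _ [delta /= d0 <-]; exact: bound.
exists (sup S); apply/cvgrPdist_lt => eps eps0.
have [_ [d1 /= d10 <-] d1S] : exists2 y, S y & sup S - eps < y.
  apply: sup_adherent => //; split=> //.
  by exists (exponent 1), 1 => //=.
near=> delta.
have d0 : 0 < delta by near: delta; exact: nbhs_right_gt.
have dS : exponent delta <= sup S by apply: ub_le_sup => //; exists delta.
have dd : exponent d1 <= exponent delta.
  by apply/ltW/exponent_decreasing => //; near: delta; exact: nbhs_right_lt.
rewrite ger0_norm ?subr_ge0//; lra.
Unshelve. all: by end_near. Qed.

End Exponent.

(** * The walk as a Markov chain of covered sets and positions *)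

Section FiniteLaw.
Context {R : realType} {d : measure_display} {T : measurableType d}.
Variable P : probability T R.

Definition finite_rv (F : finType) (f : T -> F) :=
  forall x, measurable [set w | f w = x].

Definition law (F : finType) (f : T -> F) (x : F) : R := fine (P [set w | f w = x]).

Lemma law_ge0 (F : finType) (f : T -> F) x : 0 <= law f x.
Proof. by rewrite fine_ge0. Qed.

Lemma preim_bigcup (F : finType) (f : T -> F) (Q : pred F) :
  [set w | Q (f w)] = \bigcup_(x in [set x | Q x]) [set w | f w = x].
Proof.
apply/seteqP; split => [w Qw|w [x Qx /= fx]]; first by exists (f w).
by rewrite /= fx.
Qed.

Lemma finite_rv_measurable (F : finType) (f : T -> F) (Q : pred F) :
  finite_rv f -> measurable [set w | Q (f w)].
Proof. by move=> mf; rewrite preim_bigcup; exact: fin_bigcup_measurable. Qed.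

Lemma finite_rv_comp (F G : finType) (f : T -> F) (g : F -> G) :
  finite_rv f -> finite_rv (fun w => g (f w)).
Proof.
move=> mf x; have := @finite_rv_measurable _ f (fun y => g y == x) mf.
by congr measurable; apply/seteqP; split => w /= /eqP.
Qed.

Lemma finite_rv_pair (F G : finType) (f : T -> F) (g : T -> G) :
  finite_rv f -> finite_rv g -> finite_rv (fun w => (f w, g w)).
Proof.
move=> mf mg [x y]; have := measurableI _ _ (mf x) (mg y).
by congr measurable; apply/seteqP; split => w /= [-> ->].
Qed.

Lemma finite_rv_ffun (I F : finType) (f : I -> T -> F) :
  (forall i, finite_rv (f i)) -> finite_rv (fun w => [ffun i => f i w]).
Proof.
move=> mf p.
have -> : [set w | [ffun i => f i w] = p] = \bigcap_(i in [set: I]) [set w | f i w = p i].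
  apply/seteqP; split=> w /= => [<- i _|H]; first by rewrite /= ffunE.
  by apply/ffunP => i; rewrite ffunE; exact: H.
by apply: fin_bigcap_measurable => // i _; exact: mf.
Qed.

Lemma law_event (F : finType) (f : T -> F) (Q : pred F) : finite_rv f ->
  fine (P [set w | Q (f w)]) = \sum_(x | Q x) law f x.
Proof.
move=> mf; rewrite preim_bigcup.
rewrite (_ : [set x : F | Q x] = [set` [seq x <- index_enum F | Q x]]); last first.
  apply/seteqP; split => x /=; first by rewrite mem_filter mem_index_enum => ->.
  by rewrite mem_filter => /andP[].
rewrite measure_fin_bigcup//; last by move=> x y _ _ [w [/= -> ->]].
rewrite -fsbig_seq ?filter_uniq ?index_enum_uniq// big_filter.
rewrite (eq_bigr (fun x => (law f x)%:E)) ?sumEFin// => x _.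
by rewrite /law fineK// fin_num_measure.
Qed.

Lemma law_comp (F G : finType) (f : T -> F) (g : F -> G) : finite_rv f ->
  forall y, law (fun w => g (f w)) y = \sum_(x | g x == y) law f x.
Proof.
move=> mf y; rewrite -law_event// /law; congr (fine (P _)).
by apply/seteqP; split => w /= /eqP.
Qed.

Lemma mean_comp (F G : finType) (f : T -> F) (g : F -> G) (phi : G -> R) :
  finite_rv f ->
  \sum_y law (fun w => g (f w)) y * phi y = \sum_x law f x * phi (g x).
Proof.
move=> mf; rewrite [RHS](partition_big g predT)//=; apply: eq_bigr => y _.
by rewrite law_comp// mulr_suml; apply: eq_bigr => x /eqP ->.
Qed.

Lemma law_sum1 (F : finType) (f : T -> F) : finite_rv f -> \sum_x law f x = 1.
Proof.
move=> mf; rewrite -(law_event predT mf) (_ : [set w | _] = setT).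
  by rewrite probability_setT.
by apply/seteqP.
Qed.

End FiniteLaw.

Section WalkLaw.
Context {R : realType} {V : finType} {d : measure_display} {T : measurableType d}.
Variables (e : rel V) (P : probability T R) (delta : R) (x0 : V) (X : nat -> T -> V).
Hypotheses (e_sym : symmetric e) (e_irr : irreflexive e).
Hypotheses (e_conn : graph_connected e) (V_ge3 : (3 <= #|V|)%N).
Hypotheses (delta_gt0 : 0 < delta) (walkX : once_reinforced_walk e P delta x0 X).

Definition covered (n : nat) (w : T) : {set {set V}} := traversed (fun i => X i w) n.

Definition walk_state (n : nat) (w : T) : {set {set V}} * V := (covered n w, X n w).

Definition next_state (s : {set {set V}} * V) (y : V) : {set {set V}} * V :=
  ((edge s.2 y |: s.1)%SET, y).

Lemma traversedS (x : nat -> V) n :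
  traversed x n.+1 = (edge (x n) (x n.+1) |: traversed x n)%SET.
Proof.
apply/setP => f; rewrite finset.in_setU1; apply/imsetP/orP => [[i _ ->]|[/eqP ->|/imsetP[i _ ->]]].
- have [ltin|lein] := ltnP i n; first by right; apply/imsetP; exists (Ordinal ltin).
  have -> : i = n :> nat by apply/eqP; rewrite eqn_leq lein -ltnS ltn_ord.
  by left.
- by exists ord_max.
- by exists (widen_ord (leqnSn n) i).
Qed.

Lemma traversed_eq (x y : nat -> V) n : (forall i, (i <= n)%N -> x i = y i) ->
  traversed x n = traversed y n.
Proof.
move=> xy; apply: eq_imset => i; congr edge; apply: xy => //; exact: ltnW.
Qed.

Lemma walk_stateS n w : walk_state n.+1 w = next_state (walk_state n w) (X n.+1 w).
Proof. by rewrite /walk_state /covered traversedS. Qed.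

Lemma finite_rv_X n : finite_rv (X n).
Proof. by case: walkX => mX _ _; exact: mX. Qed.

Definition past n (w : T) : {ffun 'I_n.+1 -> V} := [ffun i : 'I_n.+1 => X i w].

Definition extend n (p : {ffun 'I_n.+1 -> V}) (i : nat) : V := p (inord i).

Lemma finite_rv_past n : finite_rv (past n).
Proof. by apply: finite_rv_ffun => i; exact: finite_rv_X. Qed.

Lemma past_cylinder n (p : {ffun 'I_n.+1 -> V}) w :
  past n w = p <-> forall i, (i <= n)%N -> X i w = extend p i.
Proof.
split=> [<- i lein|H]; first by rewrite /extend ffunE inordK.
apply/ffunP => i; have lin : (i <= n)%N by rewrite -ltnS.
rewrite ffunE (H i lin) /extend; congr (p _).
by apply/val_inj; rewrite /= inordK.
Qed.

Definition path_state n (p : {ffun 'I_n.+1 -> V}) : {set {set V}} * V :=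
  (traversed (extend p) n, extend p n).

Lemma walk_state_past n w : walk_state n w = path_state (past n w).
Proof.
have H := (past_cylinder (past n w) w).1 erefl.
by rewrite /walk_state /path_state /covered (traversed_eq H) H.
Qed.

Lemma finite_rv_state n : finite_rv (walk_state n).
Proof.
rewrite (_ : walk_state n = fun w => path_state (past n w)).
  by apply: finite_rv_comp; exact: finite_rv_past.
by apply/funext => w; exact: walk_state_past.
Qed.

(** Jumps to non-neighbours are null: the prescribed conditional probabilities
    of the neighbours already sum to one. *)
Lemma law_past_next n (p : {ffun 'I_n.+1 -> V}) u :
  law P (fun w => (past n w, X n.+1 w)) (p, u) =
  law P (past n) p * phat e delta (traversed (extend p) n) (extend p n) u.
Proof.
set f := fun w => (past n w, X n.+1 w).
have mf : finite_rv f := finite_rv_pair (@finite_rv_past n) (@finite_rv_X n.+1).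
set ph := phat e delta (traversed (extend p) n) (extend p n).
have adj v : e (extend p n) v -> law P f (p, v) = law P (past n) p * ph v.
  move=> ev; case: walkX => _ _ /(_ n (extend p) v ev) H.
  have cylE : [set w | past n w = p] =
      [set w | forall i, (i <= n)%N -> X i w = extend p i].
    by apply/seteqP; split => w /= /past_cylinder.
  have -> : ph v = fine (weight delta (traversed (extend p) n) (edge (extend p n) v) /
      \sum_(z | e (extend p n) z)
        weight delta (traversed (extend p) n) (edge (extend p n) z))%:E.
    by rewrite /ph /phat ev.
  rewrite /law -fineM//; last by rewrite fin_num_measure//; exact: finite_rv_past.
  rewrite cylE -H; congr (fine (P _)); apply/seteqP; split => w /=.
    by move=> [/past_cylinder wp ->].
  by move=> [/past_cylinder wp Xv]; rewrite /f wp Xv.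
have tot : \sum_v law P f (p, v) = law P (past n) p.
  rewrite (law_comp P fst mf) (reindex_onto (fun v => (p, v)) snd) /=.
    by apply: eq_bigl => v; rewrite !eqxx.
  by move=> [p' v] /= /eqP ->.
have ph1 : \sum_(v | e (extend p n) v) ph v = 1.
  rewrite -(phat_sum1 e_conn V_ge3 delta_gt0 (traversed (extend p) n) (extend p n)).
  rewrite [RHS](bigID (e (extend p n)))/= [X in _ = _ + X]big1 ?addr0// => v /negPf nv.
  by rewrite /phat nv.
have null : \sum_(v | ~~ e (extend p n) v) law P f (p, v) = 0.
  have := tot; rewrite (bigID (e (extend p n)))/= (eq_bigr _ adj) -mulr_sumr ph1 mulr1.
  by move=> H; apply: (addrI (law P (past n) p)); rewrite H addr0.
have [eu|neu] := boolP (e (extend p n) u); first exact: adj.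
rewrite /ph /phat (negPf neu) mulr0.
by apply: (psumr_eq0P _ null) => // v _; exact: law_ge0.
Qed.

Lemma law_state_next n s y :
  law P (fun w => (walk_state n w, X n.+1 w)) (s, y) =
  law P (walk_state n) s * phat e delta s.1 s.2 y.
Proof.
have mf := finite_rv_pair (@finite_rv_past n) (@finite_rv_X n.+1).
pose g (q : {ffun 'I_n.+1 -> V} * V) := (path_state q.1, q.2).
have -> : (fun w => (walk_state n w, X n.+1 w)) =
    (fun w => g (past n w, X n.+1 w)).
  by apply/funext => w /=; rewrite walk_state_past.
have -> : walk_state n = fun w => path_state (past n w).
  by apply/funext => w /=; rewrite walk_state_past.
rewrite (law_comp P g mf) (law_comp P _ (@finite_rv_past n)) mulr_suml.
rewrite (reindex_onto (fun p => (p, y)) fst) /=; last first.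
  by move=> [p v] /= /eqP[_ ->].
apply: eq_big => [p|p /andP[/eqP[sp] _]]; first by rewrite xpair_eqE !eqxx !andbT.
by rewrite law_past_next -sp.
Qed.

Definition state_mean n (phi : {set {set V}} * V -> R) : R :=
  \sum_s law P (walk_state n) s * phi s.

Definition transition (phi : {set {set V}} * V -> R) s : R :=
  \sum_y phat e delta s.1 s.2 y * phi (next_state s y).

(** Markov property of the pair (covered edges, position): the prescribed
    transition probabilities depend on the past only through this pair. *)
Lemma state_meanS n phi : state_mean n.+1 phi = state_mean n (transition phi).
Proof.
have mf := finite_rv_pair (@finite_rv_state n) (@finite_rv_X n.+1).
pose g (q : ({set {set V}} * V) * V) := next_state q.1 q.2.
have E : walk_state n.+1 = fun w => g (walk_state n w, X n.+1 w).
  by apply/funext => w; rewrite walk_stateS.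
rewrite /state_mean E (mean_comp P g _ mf).
pose F s y := law P (fun w => (walk_state n w, X n.+1 w)) (s, y) * phi (next_state s y).
transitivity (\sum_q F q.1 q.2); first by apply: eq_bigr => -[s y].
rewrite -(pair_bigA _ F) /=.
apply: eq_bigr => s _; rewrite /transition mulr_sumr; apply: eq_bigr => y _.
by rewrite /F law_state_next mulrA.
Qed.

Lemma covered0 w : covered 0 w = finset.set0.
Proof.
apply/setP => f; rewrite finset.in_set0; apply/negbTE/imsetP => -[[]].
by [].
Qed.

Lemma law_state0 s : law P (walk_state 0) s = (s == (finset.set0, x0))%:R.
Proof.
have H0 : law P (walk_state 0) (finset.set0, x0) = 1.
  rewrite /law (_ : [set w | _] = [set w | X 0%N w = x0]).
    by case: walkX => _ ->.
  by apply/seteqP; split => w /=; rewrite /walk_state covered0; [case|move=> ->].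
case: eqP => [-> //|/eqP sne].
have rest : \sum_(s' | s' != (finset.set0, x0)) law P (walk_state 0) s' = 0.
  have := law_sum1 P (@finite_rv_state 0).
  by rewrite (bigD1 (finset.set0, x0))//= H0 => H; apply: (addrI 1); rewrite H addr0.
by apply: (psumr_eq0P _ rest) => // s' _; exact: law_ge0.
Qed.

End WalkLaw.

(** * Tail of the cover time *)

Lemma positive_lower_bound (R : realFieldType) (F : finType) (Q : pred F) (f : F -> R) :
  (forall x, Q x -> 0 < f x) -> exists2 c, 0 < c & forall x, Q x -> c <= f x.
Proof.
move=> f0; have s0 : 0 <= \sum_(x | Q x) (f x)^-1.
  by apply: sumr_ge0 => x /f0 fx; rewrite invr_ge0 ltW.
(* Unlike a minimum, this bound makes sense when no point satisfies Q. *)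
exists (1 + \sum_(x | Q x) (f x)^-1)^-1; first by rewrite invr_gt0 ltr_wpDr.
move=> x Qx; rewrite -[leRHS]invrK lef_pV2 ?posrE ?invr_gt0 ?f0//; last first.
  by rewrite ltr_wpDr.
rewrite (bigD1 x)//= addrCA lerDl addr_ge0// sumr_ge0// => y /andP[/f0 fy _].
by rewrite invr_ge0 ltW.
Qed.

Section TailBounds.
Context {R : realType} {V : finType} {d : measure_display} {T : measurableType d}.
Variables (e : rel V) (P : probability T R) (delta : R) (x0 : V) (X : nat -> T -> V).
Hypotheses (e_sym : symmetric e) (e_irr : irreflexive e).
Hypotheses (e_conn : graph_connected e) (V_ge3 : (3 <= #|V|)%N).
Hypotheses (delta_gt0 : 0 < delta) (walkX : once_reinforced_walk e P delta x0 X).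

Local Notation mass n s := (law P (walk_state X n) s).
Local Notation mean := (state_mean P X).
Local Notation trans := (transition e delta).

Definition uncovered n : set T := [set w | ~~ (edges e \subset covered X n w)].

Definition uncovered_prob n : R := fine (P (uncovered n)).

Definition good_state (s : {set {set V}} * V) :=
  s = (finset.set0, x0) \/ (calS e x0 s.1 /\ s.2 \in endpoints s.1).

Lemma uncovered_probE n :
  uncovered_prob n = \sum_(s : {set {set V}} * V | ~~ (edges e \subset s.1)) mass n s.
Proof.
by rewrite -(law_event P (fun s : {set {set V}} * V => ~~ (edges e \subset s.1))
  (finite_rv_state walkX n)).
Qed.

Lemma good_state_next s y : good_state s -> e s.2 y -> good_state (next_state s y).
Proof.
move=> [-> /= exy|[SE xE] exy]; right; rewrite /next_state /=.
  rewrite finset.setU0; split; first exact: calS_edge.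
  by rewrite endpoints1 eqxx orbT.
by split; [exact: calSU|rewrite endpointsU eqxx orbT].
Qed.

Lemma mass_bad n s : ~ good_state s -> mass n s = 0.
Proof.
elim: n s => [|n IH] s bs.
  by rewrite (law_state0 walkX); case: eqP => // sE; case: bs; left.
have := state_meanS e_conn V_ge3 delta_gt0 walkX n (fun s' => (s' == s)%:R).
rewrite [LHS](_ : _ = mass n.+1 s).
  move=> ->; apply: big1 => s' _.
  have [gs|/IH->] := pselect (good_state s'); last by rewrite mul0r.
  rewrite /transition big1 ?mulr0// => y _.
  have [ey|ney] := boolP (e s'.2 y); last by rewrite /phat (negPf ney) mul0r.
  case: eqP => [sE|_]; last by rewrite mulr0.
  by case: bs; rewrite -sE; exact: good_state_next.
rewrite /state_mean (bigD1 s)//= eqxx mulr1 big1 ?addr0// => s' /negPf ->.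
by rewrite mulr0.
Qed.

Lemma state_mean_le n (phi psi : {set {set V}} * V -> R) :
  (forall s, good_state s -> phi s <= psi s) -> mean n phi <= mean n psi.
Proof.
move=> H; apply: ler_sum => s _.
have [/H gs|/(mass_bad n)->] := pselect (good_state s); last by rewrite !mul0r.
by rewrite ler_wpM2l// law_ge0.
Qed.

Lemma state_meanZ n c phi : mean n (fun s => c * phi s) = c * mean n phi.
Proof. by rewrite /state_mean mulr_sumr; apply: eq_bigr => s _; rewrite mulrCA. Qed.

Lemma state_mean0 phi : mean 0 phi = phi (finset.set0, x0).
Proof.
rewrite /state_mean (bigD1 (finset.set0, x0))//= (law_state0 walkX) eqxx mul1r.
by rewrite big1 ?addr0// => s /negPf sE; rewrite (law_state0 walkX) sE mul0r.
Qed.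

Lemma supersolution_bound r phi : 0 <= r ->
  (forall s, good_state s -> trans phi s <= r * phi s) ->
  forall n, mean n phi <= r ^+ n * phi (finset.set0, x0).
Proof.
move=> r0 H; elim=> [|n IH]; first by rewrite expr0 mul1r state_mean0.
rewrite (state_meanS e_conn V_ge3 delta_gt0 walkX).
apply: (le_trans (state_mean_le n H)).
by rewrite state_meanZ exprS -mulrA ler_wpM2l.
Qed.

(** The Perron vectors of all phases, glued together. In the initial state no
    covered edge can be crossed, so the constant [1] serves there. The slack [c] is
    uniform because there are finitely many states. *)
Lemma perron_family r : 0 < r ->
  (forall E, calS1 e x0 E -> radius e delta E < r) ->
  exists h : {set {set V}} * V -> R, [/\ forall s, 0 <= h s,
    forall s, good_state s -> ~~ (edges e \subset s.1) -> 0 < h s &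
    exists2 c, 0 < c & forall s, good_state s -> ~~ (edges e \subset s.1) ->
      \sum_(y | edge s.2 y \in s.1) phat e delta s.1 s.2 y * h (s.1, y) + c <=
      r * h s].
Proof.
move=> r0 radr.
have /choice[h hP] : forall E : {set {set V}}, exists h : V -> R, calS e x0 E ->
    [/\ forall x, 0 <= h x, forall x, (0 < h x) = (x \in endpoints E) &
      forall x, \sum_y inner_weight delta E x y * h y =
                radius e delta E * (total_weight e delta E x * h x)].
  move=> E; have [SE|nSE] := pselect (calS e x0 E); last by exists (fun=> 0).
  by have [h hE] := perron_vector e_conn V_ge3 delta_gt0 SE; exists h.
pose H (s : {set {set V}} * V) := if s.1 == finset.set0 then 1 else `|h s.1 s.2|.
have H0 s : 0 <= H s by rewrite /H; case: ifP.
have notS : ~ calS e x0 (finset.set0 : {set {set V}}).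
  by case=> _ _; rewrite /endpoints /finset.cover finset.big_set0 finset.in_set0.
have Hgood s : good_state s -> s.1 == finset.set0 \/
    [/\ calS e x0 s.1, s.2 \in endpoints s.1 & forall y, H (s.1, y) = h s.1 y].
  move=> [->|[SE xE]]; [by left|right; split => // y].
  rewrite /H /=; case: eqP => [E|_]; first by rewrite E in SE.
  by have [h0 _ _] := hP _ SE; rewrite ger0_norm.
have Hpos s : good_state s -> ~~ (edges e \subset s.1) -> 0 < H s.
  move=> /Hgood[sE _|[SE xE HE] _]; first by rewrite /H sE.
  by rewrite (surjective_pairing s) HE; have [_ -> _] := hP _ SE.
exists H; split=> //.
pose gap (s : {set {set V}} * V) :=
  r * H s - \sum_(y | edge s.2 y \in s.1) phat e delta s.1 s.2 y * H (s.1, y).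
have [c c0 cP] : exists2 c, 0 < c & forall s,
    `[< good_state s >] && ~~ (edges e \subset s.1) -> c <= gap s.
  apply: positive_lower_bound => s /andP[/asboolP gs nc].
  have Hs := Hpos s gs nc; rewrite /gap subr_gt0.
  have [/eqP sE|[SE xE HE]] := Hgood s gs.
    by rewrite big1 ?mulr_gt0// => y; rewrite sE finset.in_set0.
  have [sE _ _] := SE; have [_ _ hK] := hP _ SE.
  under eq_bigr do rewrite HE.
  rewrite (perron_kernel e_sym e_conn V_ge3 delta_gt0 sE (hK _)).
  rewrite -HE -surjective_pairing ltr_pM2r//; apply: radr; split=> // EE.
  by rewrite EE fintype.subxx in nc.
exists c => // s gs nc; rewrite addrC -lerBrDr; apply: cP.
by rewrite nc andbT; exact/asboolP.
Qed.

(** Weighting the Perron vector of each phase by a large constant to the number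
    of uncovered edges makes the contribution of the next phases negligible. *)
Lemma uncovered_prob_le r : 0 < r ->
  (forall E, calS1 e x0 E -> radius e delta E < r) ->
  exists K : R, forall n, uncovered_prob n <= K * r ^+ n.
Proof.
move=> r0 radr; have [h [h0 hpos [c c0 hc]]] := perron_family r0 radr.
pose M := \sum_s h s.
have hM s : h s <= M.
  by rewrite /M (bigD1 s)//= lerDl sumr_ge0.
have M0 : 0 <= M by rewrite sumr_ge0.
(* With L * c >= M, the slack c of one phase pays for entering the next. *)
pose L := (M + 1) / c.
have L0 : 0 < L by rewrite divr_gt0// ltr_wpDl.
have Lc : M <= L * c by rewrite /L divfK ?gt_eqF// lerDl.
pose phi (s : {set {set V}} * V) : R := if edges e \subset s.1 then 0
  else L ^+ #|(edges e :\: s.1)%SET| * h s.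
have phi0 s : 0 <= phi s.
  by rewrite /phi; case: ifP => // _; rewrite mulr_ge0// exprn_ge0// ltW.
have super s : good_state s -> trans phi s <= r * phi s.
  move=> gs; rewrite /transition.
  have [cov|nc] := boolP (edges e \subset s.1).
    rewrite big1 ?mulr_ge0 ?(ltW r0)// => y _.
    rewrite /phi /= (fintype.subset_trans cov) ?mulr0//.
    exact: finset.subsetUr.
  have [m mE] : exists m, #|(edges e :\: s.1)%SET| = m.+1.
    exists #|(edges e :\: s.1)%SET|.-1; rewrite prednK// lt0n cards_eq0.
    by rewrite finset.setD_eq0.
  have Lm : 0 <= L ^+ m by rewrite exprn_ge0// ltW.
  have bnd y : phat e delta s.1 s.2 y * phi (next_state s y) <=
      L ^+ m.+1 * (if edge s.2 y \in s.1 then phat e delta s.1 s.2 y * h (s.1, y) else 0)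
      + L ^+ m * M * phat e delta s.1 s.2 y.
    have p0 := phat_ge0 e_conn V_ge3 delta_gt0 s.1 s.2 y.
    have [ey|ney] := boolP (e s.2 y); last first.
      by rewrite /phat (negPf ney) !mul0r mulr0 if_same mulr0 addr0.
    case: ifP => yE.
      have -> : next_state s y = (s.1, y).
        by rewrite /next_state (finset.setUidPr _)// finset.sub1set.
      rewrite /phi /= (negPf nc) mE mulrCA lerDl.
      by rewrite mulr_ge0// mulr_ge0.
    rewrite mulr0 add0r mulrC; apply: ler_wpM2r => //.
    rewrite /phi; case: ifP => _; first by rewrite mulr_ge0.
    have -> : #|(edges e :\: (next_state s y).1)%SET| = m.
      have yD : edge s.2 y \in (edges e :\: s.1)%SET.
        by rewrite finset.in_setD yE mem_edges.
      rewrite /= finset.setUC -finset.setDDl.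
      by have := cardsD1 (edge s.2 y) (edges e :\: s.1)%SET; rewrite yD mE => -[].
    by rewrite ler_wpM2l.
  apply: (le_trans (ler_sum _ (fun y _ => bnd y))).
  rewrite big_split/= -mulr_sumr -mulr_sumr -big_mkcond/= phat_sum1// mulr1.
  rewrite /phi (negPf nc) mE mulrCA.
  apply: le_trans (ler_wpM2l _ (hc s gs nc)); last by rewrite exprn_ge0// ltW.
  rewrite mulrDr lerD2l exprS -mulrA mulrCA ler_wpM2l//.
have [k k0 kP] : exists2 k, 0 < k & forall s,
    `[< good_state s >] && ~~ (edges e \subset s.1) -> k <= phi s.
  apply: positive_lower_bound => s /andP[/asboolP gs nc].
  by rewrite /phi (negPf nc) mulr_gt0 ?hpos// exprn_gt0.
exists (k^-1 * phi (finset.set0, x0)) => n.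
rewrite -mulrA ler_pdivlMl// [leRHS]mulrC.
apply: le_trans (supersolution_bound (ltW r0) super n).
rewrite uncovered_probE mulr_sumr /state_mean.
rewrite [leRHS](bigID (fun s : {set {set V}} * V => edges e \subset s.1))/=.
rewrite -[leLHS]add0r lerD//.
  by apply: sumr_ge0 => s _; rewrite mulr_ge0// law_ge0.
apply: ler_sum => s nc; rewrite mulrC.
have [gs|/(mass_bad n)->] := pselect (good_state s); last by rewrite !mul0r.
rewrite ler_wpM2l ?law_ge0//; apply: kP; rewrite nc andbT; exact/asboolP.
Qed.

Lemma mass_step n E x y : 0 < mass n (E, x) -> e x y ->
  0 < mass n.+1 ((edge x y |: E)%SET, y).
Proof.
move=> m0 exy; set s' := (_, y).
have -> : mass n.+1 s' = mean n.+1 (fun s => (s == s')%:R).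
  rewrite /state_mean (bigD1 s')//= eqxx mulr1 big1 ?addr0// => s /negPf ->.
  by rewrite mulr0.
rewrite (state_meanS e_conn V_ge3 delta_gt0 walkX).
have t0 s : 0 <= trans (fun s => (s == s')%:R) s.
  by apply: sumr_ge0 => z _; rewrite mulr_ge0 ?phat_ge0 ?ler0n.
rewrite /state_mean (bigD1 (E, x))//= ltr_pwDl//.
  rewrite mulr_gt0// /transition (bigD1 y)//= /next_state/= eqxx mulr1 ltr_pwDl//.
    exact: phat_gt0.
  by apply: sumr_ge0 => z _; rewrite mulr_ge0 ?phat_ge0 ?ler0n.
by apply: sumr_ge0 => s _; rewrite mulr_ge0// law_ge0.
Qed.

Lemma mass_path n (E0 E : {set {set V}}) x p : E0 \subset edges e ->
  0 < mass n (E, x) -> E \subset E0 -> path (step E0) x p ->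
  exists n' (E' : {set {set V}}),
    [/\ 0 < mass n' (E', last x p), E \subset E' & E' \subset E0].
Proof.
move=> sE; elim: p n E x => [|y p IH] n E x m0 EE0 /=; first by exists n, E.
move=> /andP[xy yp].
have exy := edge_adjacent e_sym sE xy.
have sub : (edge x y |: E)%SET \subset E0.
  by rewrite finset.subUset EE0 finset.sub1set andbT.
have [n' [E' [m0' EE' E'E0]]] := IH _ _ _ (mass_step m0 exy) sub yp.
by exists n', E'; split=> //; apply: fintype.subset_trans EE'; exact: finset.subsetUr.
Qed.

(** While an edge of [E0] is missing, the walk can go to one of its ends inside
    [E0] and cross it. *)
Lemma phase_reached E0 : calS e x0 E0 ->
  exists n x, 0 < mass n (E0, x) /\ x \in endpoints E0.
Proof.
move=> [sE cE x0E].
suff H k : forall n (E : {set {set V}}) x,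
    (#|(E0 :\: E)%SET| <= k)%N -> 0 < mass n (E, x) ->
    E \subset E0 -> x \in endpoints E0 ->
    exists n x, 0 < mass n (E0, x) /\ x \in endpoints E0.
  apply: (H _ 0%N finset.set0 x0 (leqnn _)) => //; last exact: finset.sub0set.
  by rewrite (law_state0 walkX) eqxx.
elim: k => [|k IH] n E x.
  rewrite leqn0 cards_eq0 finset.setD_eq0 => E0E m0 EE0 xE; exists n, x; split=> //.
  by have <- : E = E0 by apply/eqP; rewrite finset.eqEsubset EE0.
move=> Ek m0 EE0 xE.
have [E0E|/fintype.subsetPn[f fE0 fE]] := boolP (E0 \subset E).
  by apply: (IH n E x) => //; move: E0E; rewrite -finset.setD_eq0 => /eqP ->; rewrite cards0.
have /edgesP[a [b [fab eab]]] := fintype.subsetP sE _ fE0.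
have abE0 : edge a b \in E0 by rewrite -fab.
have /connectP[p xp pa] := cE x a xE (endpoint_l abE0).
have [n' [E' [m0' EE' E'E0]]] := mass_path sE m0 EE0 xp.
rewrite -pa in m0'.
apply: (IH n'.+1 (edge a b |: E')%SET b); last exact: endpoint_r abE0.
- rewrite -ltnS; apply: leq_trans Ek; apply: proper_card; apply/properP; split.
    by apply: finset.setDS; apply: fintype.subset_trans EE' (finset.subsetUr _ _).
  exists f; first by rewrite finset.in_setD fE.
  by rewrite finset.in_setD fab !inE eqxx.
- exact: mass_step.
- by rewrite finset.subUset E'E0 finset.sub1set abE0.
Qed.

(** Averaging the Perron vector of [E0] over the paths that have covered exactly
    [E0] gives a quantity that loses at most the factor [radius] at each step. *)
Lemma uncovered_prob_ge E0 : calS1 e x0 E0 ->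
  exists2 c, 0 < c & exists n0, forall n,
    c * radius e delta E0 ^+ n <= uncovered_prob (n0 + n).
Proof.
move=> [SE neE]; have [sE _ _] := SE.
have [h [h0 hE hK]] := perron_vector e_conn V_ge3 delta_gt0 SE.
have [n0 [x [m0 xE]]] := phase_reached SE.
have [y xy] := endpointsP _ sE xE.
have rho0 := radius_gt0 e_conn V_ge3 delta_gt0 xy.
pose phi (s : {set {set V}} * V) : R := (s.1 == E0)%:R * h s.2.
have phi0 s : 0 <= phi s by rewrite mulr_ge0.
pose M := \sum_z h z.
have hM z : h z <= M by rewrite /M (bigD1 z)//= lerDl sumr_ge0.
have M0 : 0 < M by apply: lt_le_trans (hM x); rewrite hE.
have sub s : radius e delta E0 * phi s <= trans phi s.
  have [sE0|sE0] := eqVneq s.1 E0; last first.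
    rewrite {1}/phi (negPf sE0) mul0r mulr0; apply: sumr_ge0 => z _.
    by rewrite mulr_ge0 ?phat_ge0.
  have -> : phi s = h s.2 by rewrite /phi sE0 eqxx mul1r.
  rewrite -(perron_kernel e_sym e_conn V_ge3 delta_gt0 sE (hK _)) big_mkcond/=.
  apply: ler_sum => z _; case: ifP => zE; last by rewrite mulr_ge0 ?phat_ge0.
  by rewrite /phi /next_state /= sE0 (finset.setUidPr _) ?finset.sub1set// eqxx mul1r.
have grow n : radius e delta E0 ^+ n * mean n0 phi <= mean (n0 + n) phi.
  elim: n => [|n IH]; first by rewrite expr0 mul1r addn0.
  rewrite addnS (state_meanS e_conn V_ge3 delta_gt0 walkX).
  rewrite exprS -mulrA; apply: (le_trans (ler_wpM2l (ltW rho0) IH)).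
  by rewrite -state_meanZ; apply: state_mean_le => s _.
have mean0 : 0 < mean n0 phi.
  rewrite /state_mean (bigD1 (E0, x))//= ltr_pwDl//.
    by rewrite mulr_gt0// /phi eqxx mul1r hE.
  by apply: sumr_ge0 => s _; rewrite mulr_ge0 ?law_ge0.
exists (mean n0 phi / M); first by rewrite divr_gt0.
exists n0 => n; rewrite mulrAC ler_pdivrMr// mulrC.
apply: (le_trans (grow n)); rewrite uncovered_probE mulr_suml /state_mean.
rewrite (bigID (fun s : {set {set V}} * V => edges e \subset s.1))/= big1 ?add0r; last first.
  move=> s cov; rewrite /phi; case: eqP => [sE0|_]; last by rewrite mul0r mulr0.
  by case: neE; apply/eqP; rewrite finset.eqEsubset sE -sE0.
apply: ler_sum => s _; rewrite ler_wpM2l ?law_ge0//.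
by rewrite /phi; case: eqP => _; rewrite ?mul1r// mul0r ltW.
Qed.

End TailBounds.

(** * Exponential moments of the cover time *)

Lemma exprn_unbounded (R : archiRealFieldType) (x A : R) : 1 < x ->
  exists n, A <= x ^+ n.
Proof.
move=> x1; have bernoulli n : 1 + n%:R * (x - 1) <= x ^+ n.
  elim: n => [|n IH]; first by rewrite expr0 mul0r addr0.
  have n0 : 0 <= n%:R :> R by rewrite ler0n.
  rewrite exprS; apply: le_trans (ler_wpM2l _ IH); last by lra.
  rewrite -natr1 -subr_ge0 (_ : _ - _ = n%:R * (x - 1) ^+ 2); last by ring.
  by rewrite mulr_ge0 ?sqr_ge0.
exists (Num.truncn (A / (x - 1))).+1; apply: le_trans (bernoulli _).
have : A / (x - 1) < (Num.truncn (A / (x - 1))).+1%:R by exact: truncnS_gt.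
by rewrite ltr_pdivrMr ?subr_gt0// => /ltW; lra.
Qed.

Section CoverTimeMoments.
Context {R : realType} {V : finType} {d : measure_display} {T : measurableType d}.
Variables (e : rel V) (P : probability T R) (delta : R) (x0 : V) (X : nat -> T -> V).
Hypotheses (e_sym : symmetric e) (e_irr : irreflexive e).
Hypotheses (e_conn : graph_connected e) (V_ge3 : (3 <= #|V|)%N).
Hypotheses (delta_gt0 : 0 < delta) (walkX : once_reinforced_walk e P delta x0 X).

Lemma traversed_mono (x : nat -> V) m n : (m <= n)%N ->
  traversed x m \subset traversed x n.
Proof.
move=> /subnK <-; elim: (n - m)%N => [|k IH]; first by rewrite add0n.
apply: (fintype.subset_trans IH); rewrite addSn traversedS.
exact: finset.subsetUr.
Qed.

Lemma measurable_uncovered n : measurable (uncovered e X n).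
Proof.
exact: (finite_rv_measurable
  (fun s : {set {set V}} * V => ~~ (edges e \subset s.1)) (finite_rv_state walkX n)).
Qed.

Section Moment.
Variable a : R.
Hypothesis a_gt0 : 0 < a.

Definition increment n : R := (expR a - 1) * expR a ^+ n.

Lemma increment_ge0 n : 0 <= increment n.
Proof.
by rewrite mulr_ge0 ?exprn_ge0 ?expR_ge0// subr_ge0 ltW// expR_gt1.
Qed.

Lemma increment_sum n : \sum_(0 <= i < n) increment i = expR a ^+ n - 1.
Proof. by rewrite subrX1 big_mkord -mulr_sumr. Qed.

(** The exponential telescopes over the times at which some edge is still
    uncovered; on a path that never covers the graph both sides are infinite. As
    the terms on the right are measurable, this also makes the cover time
    accessible to integration. *)
Lemma expeR_cover_time w :
  expeR (a%:E * edge_cover_time R e X w) =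
  (1 + \sum_(n <oo) (increment n * \1_(uncovered e X n) w)%:E)%E.
Proof.
have term_ge0 n : (0 <= (increment n * \1_(uncovered e X n) w)%:E)%E.
  by rewrite lee_fin mulr_ge0 ?increment_ge0// indicE ler0n.
have [[t ct]|nc] := pselect (exists t, edges e \subset covered X t w).
- have [N cN minN] := ex_minnP
    (ex_intro (fun n => edges e \subset covered X n w) t ct).
  have CN : edge_cover_time R e X w = N%:R%:E.
    apply/eqP; rewrite eq_le; apply/andP; split.
      by apply: ereal_inf_lbound; exists N.
    by apply: le_ereal_inf_tmp => _ [m cm <-]; rewrite lee_fin ler_nat minN.
  rewrite CN -EFinM /= expRM_natr (nneseries_split 0 N)// add0n.
  rewrite eseries0 ?adde0; last first.
    move=> k Nk _; rewrite indicE memNset ?mulr0//= /uncovered /= => /negP; apply.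
    exact: (fintype.subset_trans cN (traversed_mono _ Nk)).
  rewrite (eq_big_nat _ _ (F2 := fun k => (increment k)%:E)).
    by rewrite sumEFin increment_sum -EFinD subrKC.
  move=> k /andP[_ kN]; rewrite indicE mem_set ?mulr1//= /uncovered /=.
  by apply/negP => /minN; rewrite leqNgt kN.
- have CN : edge_cover_time R e X w = +oo%E.
    rewrite /edge_cover_time (_ : [set t | _] = set0) ?image_set0 ?ereal_inf0//.
    by apply/seteqP; split => // t ct; apply: nc; exists t.
  rewrite CN gt0_muley ?lte_fin//=; apply/esym/eqyP => A A0.
  have [N AN] := exprn_unbounded A (eqbRL (expR_gt1 a) a_gt0).
  have : ((expR a ^+ N - 1)%:E <= \sum_(n <oo) (increment n * \1_(uncovered e X n) w)%:E)%E.
    rewrite -increment_sum -sumEFin; apply: le_trans (nneseries_lim_ge N _) => //.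
    apply: lee_sum => k _; rewrite lee_fin indicE mem_set ?mulr1//= /uncovered /=.
    by apply/negP => cov; apply: nc; exists k.
  move=> /(leeD2l 1); apply: le_trans.
  by rewrite -EFinD lee_fin subrKC.
Qed.

Lemma cover_time_moment :
  (\int[P]_w expeR (a%:E * edge_cover_time R e X w) =
   1 + \sum_(n <oo) (increment n * uncovered_prob e P X n)%:E)%E.
Proof.
have term_ge0 n w : (0 <= (increment n * \1_(uncovered e X n) w)%:E)%E.
  by rewrite lee_fin mulr_ge0 ?increment_ge0// indicE ler0n.
have mterm n : measurable_fun [set: T]
    ((fun w => (increment n * \1_(uncovered e X n) w)%:E) : T -> \bar R).
  apply/measurable_EFinP; apply: measurable_funM => //.
  by apply: measurable_indic; exact: measurable_uncovered.
under eq_integral do rewrite expeR_cover_time.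
rewrite ge0_integralD//; last 2 first.
- by move=> w _; apply: nneseries_ge0.
- by apply: ge0_emeasurable_sum.
rewrite integral_cst//; congr (_ + _)%E; first by rewrite mul1e; exact: probability_setT.
rewrite integral_nneseries//; apply: eq_eseriesr => n _.
under eq_integral do rewrite EFinM.
rewrite ge0_integralZl_EFin ?increment_ge0//; last first.
  apply/measurable_EFinP; apply: measurable_indic; exact: measurable_uncovered.
rewrite integral_indic ?setIT//; last exact: measurable_uncovered.
rewrite [RHS]EFinM; congr (_ * _)%E; apply/esym/fineK.
by apply: fin_num_measure; exact: measurable_uncovered.
Qed.

End Moment.

(** The tail bound turns the series of [cover_time_moment] into a convergent
    geometric series. *)
Lemma moment_finite a r : 0 < a -> 0 < r -> expR a * r < 1 ->
  (forall E, calS1 e x0 E -> radius e delta E < r) ->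
  (\int[P]_w expeR (a%:E * edge_cover_time R e X w) < +oo)%E.
Proof.
move=> a0 r0 ar1 radr; rewrite cover_time_moment//.
have [K KP] := uncovered_prob_le e_sym e_conn V_ge3 delta_gt0 walkX r0 radr.
have ea0 := expR_gt0 a.
have u0 n : 0 <= uncovered_prob e P X n by rewrite fine_ge0.
have K0 : 0 <= K by have := le_trans (u0 0%N) (KP 0%N); rewrite expr0 mulr1.
have e1 : 0 <= expR a - 1 by rewrite subr_ge0 ltW// expR_gt1.
set q := expR a * r in ar1; have q0 : 0 < q by rewrite mulr_gt0.
pose C := (expR a - 1) * K * (1 - q)^-1.
suff : (\sum_(n <oo) (increment a n * uncovered_prob e P X n)%:E <= C%:E)%E.
  by move=> H; apply: lte_add_pinfty; [exact: ltry|exact: le_lt_trans H (ltry _)].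
apply: lime_le.
  by apply: is_cvg_nneseries => n _ _; rewrite lee_fin mulr_ge0 ?increment_ge0.
apply: nearW => n; rewrite sumEFin lee_fin.
apply: (@le_trans _ _ (series (geometric ((expR a - 1) * K) q) n)).
  apply: ler_sum => i _; rewrite /increment /= /q exprMn.
  rewrite -!mulrA ler_wpM2l// mulrCA ler_wpM2l ?exprn_ge0 ?expR_ge0//.
by apply: geometric_le_lim; rewrite ?mulr_ge0// ger0_norm// ltW.
Qed.

(** The terms of the series of [cover_time_moment] are unbounded. *)
Lemma moment_infinite a E0 : 0 < a -> calS1 e x0 E0 ->
  1 < expR a * radius e delta E0 ->
  (\int[P]_w expeR (a%:E * edge_cover_time R e X w) = +oo)%E.
Proof.
move=> a0 ES ar1; rewrite cover_time_moment//.
have [c c0 [n0 cP]] := uncovered_prob_ge e_sym e_conn V_ge3 delta_gt0 walkX ES.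
have u0 n : 0 <= uncovered_prob e P X n by rewrite fine_ge0.
have term_ge0 n : (0 <= (increment a n * uncovered_prob e P X n)%:E)%E.
  by rewrite lee_fin mulr_ge0 ?increment_ge0.
set q := expR a * _ in ar1.
apply/eqyP => A A0.
have e1 : 0 < expR a - 1 by rewrite subr_gt0 expR_gt1.
pose k := (expR a - 1) * expR a ^+ n0 * c.
have k0 : 0 < k by rewrite !mulr_gt0// exprn_gt0// expR_gt0.
have [n nP] : exists n, A / k <= q ^+ n.
  exact: exprn_unbounded.
apply: (@le_trans _ _ ((increment a (n0 + n) * uncovered_prob e P X (n0 + n))%:E)).
  rewrite lee_fin; apply: (@le_trans _ _ (k * q ^+ n)).
    by rewrite -ler_pdivrMl// mulrC.
  rewrite /k /increment /q exprMn exprD -!mulrA ler_pM2l//.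
  rewrite ler_pM2l ?exprn_gt0 ?expR_gt0// mulrCA ler_pM2l ?exprn_gt0 ?expR_gt0//.
rewrite -[leLHS]add0e leeD//.
apply: le_trans (nneseries_lim_ge (n0 + n).+1 _) => //.
by rewrite big_nat_recr//= leeDr// sume_ge0.
Qed.

End CoverTimeMoments.

(** The slowest phase [E0] governs the tail: [expR a] times its decay rate is
    less than one exactly when [a] is below the exponent. *)
Lemma critical_exponentE (R : realType) (V : finType) (e : rel V) (x0 : V)
    (delta : R) (d : measure_display) (T : measurableType d)
    (P : probability T R) (X : nat -> T -> V) :
  symmetric e -> irreflexive e -> graph_connected e -> (3 <= #|V|)%N ->
  0 < delta -> once_reinforced_walk e P delta x0 X ->
  critical_exponent e P X = (exponent e x0 delta)%:E.
Proof.
move=> e_sym e_irr e_conn V_ge3 d0 walkX.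
have [E0 [ES alphaE E0max]] := exponentP x0 e_sym e_conn V_ge3 d0.
have alpha0 : 0 < exponent e x0 delta by exact: exponent_gt0.
have rho0 : 0 < radius e delta E0 := calS1_radius_gt0 e_conn V_ge3 d0 ES.
have rhoE : radius e delta E0 = expR (- exponent e x0 delta).
  by rewrite alphaE opprK lnK// posrE.
apply/eqP; rewrite eq_le; apply/andP; split.
  apply: ge_ereal_sup => _ [a afin <-]; rewrite lee_fin leNgt; apply/negP => aalpha.
  have a0 := lt_trans alpha0 aalpha.
  move: afin => /=; rewrite (moment_infinite e_sym e_conn V_ge3 d0 walkX a0 ES) ?ltxx//.
  by rewrite rhoE -expRD expR_gt1 subr_gt0.
have below a : 0 < a -> a < exponent e x0 delta ->
    (a%:E <= critical_exponent e P X)%E.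
  move=> a0 aalpha; apply: ereal_sup_ubound; exists a => //=.
  pose b := (a + exponent e x0 delta) / 2.
  have ab : a < b by rewrite /b; lra.
  have balpha : b < exponent e x0 delta by rewrite /b; lra.
  apply: (moment_finite e_sym e_conn V_ge3 d0 walkX a0 (expR_gt0 (- b))).
    by rewrite -expRD expR_lt1 subr_lt0.
  move=> E ESE; apply: (le_lt_trans (E0max E ESE)).
  by rewrite rhoE ltr_expR ltrN2.
apply/lee_subgt0Pr => eps eps0; rewrite -EFinB.
have [small|large] := leP (exponent e x0 delta - eps) (exponent e x0 delta / 2).
  apply: le_trans (below (exponent e x0 delta / 2) _ _); first by rewrite lee_fin.
    by rewrite divr_gt0.
  by lra.
by apply: below; lra.
Qed.

Theorem theorem1p2 (R : realType) (V : finType) (e : rel V) (x0 : V)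
    (e_sym : symmetric e) (e_irr : irreflexive e)
    (e_conn : graph_connected e) (V_ge3 : (3 <= #|V|)%N) :
  let alpha := fun delta : R => fine (alpha_c1 e x0 delta) in
  [/\ (* alpha_c1 is the critical exponent of C_E, and it is finite *)
      (forall delta : R, 0 < delta ->
         alpha_c1 e x0 delta \is a fin_num /\
         forall (d : measure_display) (T : measurableType d)
                (P : probability T R) (X : nat -> T -> V),
           once_reinforced_walk e P delta x0 X ->
           critical_exponent e P X = alpha_c1 e x0 delta),
      (* (a) *)
      [/\ forall delta : R, 0 < delta -> {for delta, continuous alpha},
          forall s t : R, 0 < s -> s < t -> alpha t < alpha s
        & forall delta0 : R, 0 < delta0 ->
            forall eps : R, 0 < eps -> exists2 eta : R, 0 < eta &
              forall s t : R, delta0 <= s -> delta0 <= t ->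
                `|s - t| < eta -> `|alpha s - alpha t| < eps],
      (* (b) *)
      alpha delta @[delta --> +oo%R] --> (0 : R)
      (* (c) *)
    & (#|V| = 3%N \/ star_shaped e ->
         alpha delta @[delta --> 0^'+] --> +oo%R) /\
      (~ (#|V| = 3%N \/ star_shaped e) ->
         exists l : R, alpha delta @[delta --> 0^'+] --> l)].
Proof.
move=> alpha; have meetP := edges_meetP e_sym e_irr e_conn V_ge3.
split.
- move=> delta d0.
  have afin : alpha_c1 e x0 delta \is a fin_num.
    by have [E0 [_ -> _]] := alpha_c1E e_sym e_conn V_ge3 d0 x0.
  split=> // d T P X walkX.
  by rewrite (critical_exponentE e_sym e_irr e_conn V_ge3 d0 walkX) /exponent fineK.
- split.
  + by move=> delta d0; exact: exponent_continuous.
  + by move=> s t; exact: exponent_decreasing.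
  + by move=> delta0 d0 eps eps0; exact: exponent_uniform.
- exact: exponent_cvg_pinfty.
- split.
  + by move=> /meetP; exact: exponent_cvg0_pinfty.
  + by move=> nmeet; apply: exponent_cvg0_finite => // /meetP.
Qed.
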